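(* Let $(\lambda_n)_{n\ge0}$ be an increasing sequence of non-negative real numbers tending to infinity, let $(c_n)_{n\ge0}$ be complex numbers, and suppose $$\sum_{\lambda_n\le x}\lambda_n|c_n|=O(x)\quad(x\to\infty).$$ Let $\ell\in\mathbb{C}$. Then the following six statements are equivalent. The series $\sum_{n=0}^\infty c_n$ is: (a) $(\mathrm{L},\{\lambda_n\})$ summable to $\ell$; (b) $(\gamma,\{\lambda_n\},\kappa)$ summable to $\ell$ for some $\kappa\ge1$; (c) $(\gamma,\{\lambda_n\},\kappa)$ summable to $\ell$ for all $\kappa\ge1$; (d) $(\mathrm{R},\{\lambda_n\},\beta)$ summable to $\ell$ for some $\beta>0$; (e) $(\mathrm{R},\{\lambda_n\},\beta)$ summable to $\ell$ for all $\beta>0$; (f) $(\mathrm{A},\{\lambda_n\})$ summable to $\ell$.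
   Context: Riesz summability: $\sum c_n=\ell$ $(\mathrm{R},\{\lambda_n\},\beta)$ means $\lim_{x\to\infty}\sum_{\lambda_n\le x}c_n(1-\lambda_n/x)^\beta=\ell$. Abel-type summability: $\sum c_n=\ell$ $(\mathrm{A},\{\lambda_n\})$ means $\sum_n c_ne^{-\lambda_ny}$ converges for every $y>0$ and tends to $\ell$ as $y\to0^+$. Young functions: for $\kappa>0$, $\gamma_\kappa(x)=\frac{\kappa}{x}\int_0^x(1-t/x)^{\kappa-1}\cos t\,dt$ (with $\gamma_\kappa(0)=1$). $\sum c_n=\ell$ $(\gamma,\{\lambda_n\},\kappa)$ means $\sum_n c_n\gamma_\kappa(\lambda_nh)$ converges for all sufficiently small $h>0$ and tends to $\ell$ as $h\to0^+$. $\sum c_n=\ell$ $(\mathrm{L},\{\lambda_n\})$ means $\sum c_n=\ell$ $(\gamma,\{\lambda_n\},1)$ and additionally $\sum_{\lambda_n>0}c_n\frac{e^{i\lambda_nh}}{\lambda_nh}$ converges for all sufficiently small $|h|>0$. *)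

(* Defs.v *)
From Stdlib Require Import Reals.
From Coquelicot Require Import Coquelicot.
Open Scope R_scope.

(* real power b^e for b >= 0 (with 0^0 = 1, 0^e = 0 for e <> 0) *)
Definition pw (b e : R) : R :=
  if Rlt_dec 0 b then Rpower b e
  else if Req_EM_T e 0 then 1 else 0.

(* value of a complex series (componentwise); for a convergent (in particular
   an eventually zero) series this is its sum *)
Definition CSeries (a : nat -> C) : C :=
  (Series (fun n => Re (a n)), Series (fun n => Im (a n))).

(* finite sum over {n | lam n <= x} (finite since lam -> +oo) *)
Definition sum_le (lam : nat -> R) (f : nat -> C) (x : R) : C :=
  CSeries (fun n => if Rle_dec (lam n) x then f n else RtoC 0).

Definition sum_le_R (lam : nat -> R) (f : nat -> R) (x : R) : R :=
  Series (fun n => if Rle_dec (lam n) x then f n else 0).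

Definition Riesz_summable (lam : nat -> R) (c : nat -> C) (beta : R) (l : C) : Prop :=
  filterlim (fun x => sum_le lam (fun n => (c n * RtoC (pw (1 - lam n / x) beta))%C) x)
    (Rbar_locally p_infty) (locally l).

Definition Abel_summable (lam : nat -> R) (c : nat -> C) (l : C) : Prop :=
  (forall y, 0 < y -> ex_series (fun n => (c n * RtoC (exp (- (lam n * y))))%C)) /\
  filterlim (fun y => CSeries (fun n => (c n * RtoC (exp (- (lam n * y))))%C))
    (at_right 0) (locally l).

Definition young (kappa x : R) : R :=
  if Req_EM_T x 0 then 1
  else kappa / x * RInt (fun t => pw (1 - t / x) (kappa - 1) * cos t) 0 x.

Definition gamma_summable (lam : nat -> R) (c : nat -> C) (kappa : R) (l : C) : Prop :=
  (exists h0, 0 < h0 /\ forall h, 0 < h < h0 ->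
      ex_series (fun n => (c n * RtoC (young kappa (lam n * h)))%C)) /\
  filterlim (fun h => CSeries (fun n => (c n * RtoC (young kappa (lam n * h)))%C))
    (at_right 0) (locally l).

Definition cexpi (t : R) : C := (cos t, sin t).

Definition L_summable (lam : nat -> R) (c : nat -> C) (l : C) : Prop :=
  gamma_summable lam c 1 l /\
  (exists h0, 0 < h0 /\ forall h, 0 < Rabs h < h0 ->
      ex_series (fun n => if Rlt_dec 0 (lam n)
                          then (c n * cexpi (lam n * h) / RtoC (lam n * h))%C
                          else RtoC 0)).

(* Main.v *)
Require Import Defs.
From Stdlib Require Import Reals Lra Lia.
From Coquelicot Require Import Coquelicot.
Open Scope R_scope.

(** All five methods are limits, as [h -> 0+], of means [sum_n c_n phi (lam_n h)] for a real kernel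
    [phi]; real and imaginary parts are treated separately.  The hypothesis bounds
    [sum_n |c_n| w (lam_n h)] uniformly in [h <= 1] for a weight [w] of order [sqrt x] at [0] and
    [1 / sqrt x] at infinity, so the kernels whose means tend to [phi 0 * l] are closed under linear
    combinations, dilations and limits in the [w]-weighted sup norm.
    If all powers [u^k], [k >= 1], of [u = exp (- x)] or of [u = 1 / (1 + x^2)] are such kernels, then
    by Weierstrass' theorem in the variable [u] so is every continuous [phi] with
    [phi x - phi 0 = O(x)] and [phi x = O(1 / (1 + x))], hence all kernels in question.
    These generators are reached by averaging dilations against [exp (- u)]: the Riesz kernels
    average to [exp (- x)] and the Young functions to [1 / (1 + x^2)], whose powers are then obtained
    by differentiating in the dilation parameter. *)

(** * Real powers and comparison by derivatives *)

(** The statement is Tauberian in the style of Wiener, on the half-line under dilations.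
    Non-vanishing of Mellin transforms is replaced by explicit averages that reach one generator
    from each family of kernels. The obstacle is logarithmic: the hypothesis allows [sum |c_n|] over
    [lam_n <= 1 / h] to grow like [log (1 / h)], so [sum |c_n| / (1 + lam_n h)] converges for each
    [h] but need not stay bounded as [h -> 0+]. Approximation of kernels in the sup norm, or
    relative to [1 / (1 + x)], is therefore not enough. Approximants must agree with the kernel at
    [0], and [w 0 = 0] forces this. The square root is a compromise: the sums stay bounded because
    [w (x) / x] is integrable on the half-line, while errors of size [min (x, 1 / x)] are [o(w)] at
    both ends. Any exponent strictly between [0] and [1] has these two properties. The averages are
    truncated at a finite [r], so that only proper integrals occur; the truncation error is again
    [O(1 / r)] relative to [w]. *)

Lemma le_div_of_mult (a b c : R) : 0 < c -> a * c <= b -> a <= b / c.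
Proof. intros Hc. now apply Rle_div_r. Qed.

Lemma div_le_of_mult (a b c : R) : 0 < c -> a <= b * c -> a / c <= b.
Proof. intros Hc. now apply Rle_div_l. Qed.

(** Monotonicity of [g + f] and [g - f]. Derivatives are asked for only inside the interval because
    [pw _ e] with [0 < e < 1] is continuous but not differentiable at [0], which is an endpoint in
    the uses below. *)
Lemma Rabs_diff_le_of_derive (f g df dg : R -> R) (a b : R) :
  a <= b ->
  (forall x, a <= x <= b -> continuity_pt f x) ->
  (forall x, a <= x <= b -> continuity_pt g x) ->
  (forall x, a < x < b -> is_derive f x (df x)) ->
  (forall x, a < x < b -> is_derive g x (dg x)) ->
  (forall x, a < x < b -> Rabs (df x) <= dg x) ->
  Rabs (f b - f a) <= g b - g a.
Proof.
  intros Hab Cf Cg Df Dg Hd.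
  destruct (Req_dec a b) as [->|Hne].
  { rewrite !Rminus_diag, Rabs_R0. lra. }
  assert (Hmono : forall k dk : R -> R,
    (forall x, a <= x <= b -> continuity_pt k x) ->
    (forall x, a < x < b -> is_derive k x (dk x)) ->
    (forall x, a < x < b -> 0 <= dk x) -> 0 <= k b - k a).
  { intros k dk Ck Dk Hk.
    assert (pr : forall c, a < c < b -> derivable_pt k c).
    { intros c Hc. exists (dk c). apply is_derive_Reals, Dk, Hc. }
    destruct (MVT k id a b pr (fun c _ => derivable_pt_id c)) as (c & Hc & E).
    - lra.
    - exact Ck.
    - intros c _. apply derivable_continuous_pt, derivable_pt_id.
    - rewrite derive_pt_id in E. unfold id in E.
      rewrite (derive_pt_eq_0 k c (dk c) (pr c Hc)) in E.
      + specialize (Hk c Hc). nra.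
      + apply is_derive_Reals, Dk, Hc. }
  apply Rabs_le. split.
  - enough (0 <= (f b + g b) - (f a + g a)) by lra.
    apply (Hmono (fun x => f x + g x) (fun x => df x + dg x)).
    + intros x Hx. apply (continuity_pt_plus f g); auto.
    + intros x Hx. apply (is_derive_plus (V := R_NormedModule)); auto.
    + intros x Hx. specialize (Hd x Hx). apply Rabs_le_between in Hd. lra.
  - enough (0 <= (g b - f b) - (g a - f a)) by lra.
    apply (Hmono (fun x => g x - f x) (fun x => dg x - df x)).
    + intros x Hx. apply (continuity_pt_minus g f); auto.
    + intros x Hx. apply (is_derive_minus (V := R_NormedModule)); auto.
    + intros x Hx. specialize (Hd x Hx). apply Rabs_le_between in Hd. lra.
Qed.

Lemma eq_of_derive (f g d : R -> R) (a b : R) :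
  a <= b ->
  (forall x, a <= x <= b -> continuity_pt f x) ->
  (forall x, a <= x <= b -> continuity_pt g x) ->
  (forall x, a < x < b -> is_derive f x (d x)) ->
  (forall x, a < x < b -> is_derive g x (d x)) ->
  f b - f a = g b - g a.
Proof.
  intros Hab Cf Cg Df Dg.
  enough (Rabs ((f b - g b) - (f a - g a)) <= 0 - 0).
  { rewrite Rminus_diag in H. pose proof (Rabs_pos (f b - g b - (f a - g a))).
    assert (E : Rabs (f b - g b - (f a - g a)) = 0) by lra.
    apply Rabs_eq_0 in E. lra. }
  apply (Rabs_diff_le_of_derive (fun x => f x - g x) (fun _ => 0) (fun x => d x - d x) (fun _ => 0)).
  - exact Hab.
  - intros x Hx. apply (continuity_pt_minus f g); auto.
  - intros x _. apply continuity_pt_const. intros ? ?; reflexivity.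
  - intros x Hx. apply (is_derive_minus (V := R_NormedModule)); auto.
  - intros x _. apply (is_derive_const (V := R_NormedModule)).
  - intros x _. rewrite Rminus_diag, Rabs_R0. lra.
Qed.

Lemma pw_Rpower (b e : R) : 0 < b -> pw b e = Rpower b e.
Proof. intros H. unfold pw. destruct (Rlt_dec 0 b); [reflexivity|lra]. Qed.

Lemma pw_nonpos_base (b e : R) : b <= 0 -> e <> 0 -> pw b e = 0.
Proof.
  intros H He. unfold pw. destruct (Rlt_dec 0 b); [lra|].
  destruct (Req_EM_T e 0); [contradiction|reflexivity].
Qed.

Lemma pw_exp0 (b : R) : pw b 0 = 1.
Proof.
  unfold pw. destruct (Rlt_dec 0 b); [now apply Rpower_O|].
  destruct (Req_EM_T 0 0); [reflexivity|lra].
Qed.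

Lemma Rpower_pos (b e : R) : 0 < Rpower b e.
Proof. apply exp_pos. Qed.

Lemma pw_pos (b e : R) : 0 < b -> 0 < pw b e.
Proof. intros H. rewrite pw_Rpower by exact H. apply Rpower_pos. Qed.

Lemma pw_ge0 (b e : R) : 0 <= pw b e.
Proof.
  unfold pw. destruct (Rlt_dec 0 b); [left; apply Rpower_pos|].
  destruct (Req_EM_T e 0); lra.
Qed.

(** Only the scaling factor [y] has to be positive: [s] will be [1 - x / u], which is negative
    beyond the cut-off of the Riesz kernel. *)
Lemma pw_mult (s y e : R) : 0 < y -> pw (s * y) e = pw s e * pw y e.
Proof.
  intros Hy. destruct (Rlt_dec 0 s) as [Hs|Hs].
  - rewrite !pw_Rpower by (try apply Rmult_lt_0_compat; assumption).
    symmetry. apply Rpower_mult_distr; assumption.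
  - destruct (Req_dec e 0) as [->|He].
    + rewrite !pw_exp0. ring.
    + rewrite (pw_nonpos_base s), (pw_nonpos_base (s * y)) by (auto; nra). ring.
Qed.

Lemma pw_pred (x k : R) : 0 <= x -> k <> 0 -> pw x k = x * pw x (k - 1).
Proof.
  intros Hx Hk. destruct (Req_dec x 0) as [->|H0].
  - rewrite pw_nonpos_base by lra. ring.
  - assert (0 < x) by lra. rewrite !pw_Rpower by assumption.
    rewrite <- (Rpower_1 x) at 2 by assumption. rewrite <- Rpower_plus.
    f_equal. ring.
Qed.

Lemma pw_le (x y e : R) : x <= y -> 0 <= e -> pw x e <= pw y e.
Proof.
  intros Hxy He. destruct (Rlt_dec 0 x) as [Hx|Hx].
  - rewrite !pw_Rpower by lra. apply Rle_Rpower_l; lra.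
  - destruct (Req_dec e 0) as [->|He0].
    + rewrite !pw_exp0. lra.
    + rewrite (pw_nonpos_base x) by (auto; lra). apply pw_ge0.
Qed.

Lemma pw_base1 (e : R) : pw 1 e = 1.
Proof.
  rewrite pw_Rpower by lra. unfold Rpower. rewrite ln_1, Rmult_0_r. apply exp_0.
Qed.

Lemma is_derive_pw (x e : R) :
  0 < x -> is_derive (fun y => pw y e) x (e * pw x (e - 1)).
Proof.
  intros Hx. rewrite pw_Rpower by exact Hx.
  apply (is_derive_ext_loc (fun y => Rpower y e)).
  - exists (mkposreal x Hx). intros y Hy. symmetry. apply pw_Rpower.
    apply Rabs_lt_between in Hy. change (- x < y - x < x) in Hy. lra.
  - apply is_derive_Reals. now apply derivable_pt_lim_power.
Qed.

Lemma continuity_pt_pw (e x : R) : 0 <= e -> continuity_pt (fun y => pw y e) x.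
Proof.
  intros He. destruct (Req_dec e 0) as [->|He0].
  { apply (continuity_pt_ext (fun _ => 1)).
    - intros y. symmetry. apply pw_exp0.
    - apply continuity_pt_const. intros ? ?; reflexivity. }
  destruct (Rtotal_order x 0) as [Hx|[->|Hx]].
  - apply continuity_pt_filterlim.
    apply (filterlim_ext_loc (fun _ => 0)).
    + assert (Hx' : 0 < - x) by lra. exists (mkposreal _ Hx'). intros y Hy.
      apply Rabs_lt_between in Hy. change (- - x < y - x < - x) in Hy.
      symmetry. apply pw_nonpos_base; lra.
    + rewrite (pw_nonpos_base x) by lra. apply filterlim_const.
  (* At [0] the modulus is explicit: [y^e < eps] as soon as [y < eps^(1/e)]. *)
  - intros eps Heps. exists (Rpower eps (/ e)). split; [apply Rpower_pos|].
    intros y [_ Hy]. simpl in *. unfold R_dist in *.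
    rewrite (pw_nonpos_base 0), Rminus_0_r in * by lra.
    rewrite Rabs_pos_eq by apply pw_ge0.
    destruct (Rlt_dec 0 y) as [Hy0|Hy0].
    + rewrite Rabs_pos_eq in Hy by lra. rewrite pw_Rpower by exact Hy0.
      replace eps with (Rpower (Rpower eps (/ e)) e).
      * apply Rlt_Rpower_l; lra.
      * rewrite Rpower_mult, Rinv_l by exact He0. now apply Rpower_1.
    + rewrite pw_nonpos_base by lra. exact Heps.
  - apply derivable_continuous_pt. exists (e * pw x (e - 1)).
    apply is_derive_Reals. now apply is_derive_pw.
Qed.

(** The inequality [ln q < q] at [q = x / (2 (p + 1))] gives [(p + 1) ln x < (p + 1) ln (2 (p + 1))
    + x / 2], hence the constant [(2 (p + 1))^(p + 1)]. *)
Lemma pw_mul_exp_bounded (p : R) : 0 < p ->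
  exists B, 0 < B /\ forall x, 0 < x -> pw x p * exp (- x) * x <= B.
Proof.
  intros Hp. exists (Rpower (2 * (p + 1)) (p + 1)). split; [apply Rpower_pos|].
  intros x Hx. rewrite pw_Rpower by exact Hx.
  replace (Rpower x p * exp (- x) * x) with (Rpower x (p + 1) * exp (- x)).
  2:{ rewrite Rpower_plus, Rpower_1 by exact Hx. ring. }
  unfold Rpower. rewrite <- exp_plus. apply Rlt_le, exp_increasing.
  assert (Hq : 0 < x / (2 * (p + 1))) by (apply Rdiv_lt_0_compat; lra).
  assert (Hln : ln (x / (2 * (p + 1))) < x / (2 * (p + 1))).
  { rewrite <- (ln_exp (x / (2 * (p + 1)))) at 2. apply ln_increasing; [exact Hq|].
    pose proof (exp_ineq1 (x / (2 * (p + 1)))). lra. }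
  rewrite ln_div in Hln by lra.
  apply Rmult_lt_compat_l with (r := p + 1) in Hln; [|lra].
  replace ((p + 1) * (x / (2 * (p + 1)))) with (x / 2) in Hln by (field; lra).
  lra.
Qed.

(** * Young functions and Laplace averages *)

Lemma continuous_of_continuity_pt (f : R -> R) (x : R) :
  continuity_pt f x -> continuous f x.
Proof. intros H. now apply continuity_pt_filterlim. Qed.

Lemma ex_RInt_of_continuity (f : R -> R) (a b : R) :
  continuity f -> ex_RInt f a b.
Proof.
  intros H. apply (ex_RInt_continuous (V := R_CompleteNormedModule)).
  intros z _. apply continuous_of_continuity_pt, H.
Qed.

Lemma is_derive_RInt_of_continuity (f : R -> R) (a b : R) :
  continuity f -> is_derive (fun u => RInt f a u) b (f b).
Proof.
  intros H. apply (is_derive_RInt (V := R_NormedModule) f (fun u => RInt f a u) a b).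
  - apply filter_forall. intros u.
    apply (RInt_correct (V := R_CompleteNormedModule)). now apply ex_RInt_of_continuity.
  - apply continuous_of_continuity_pt, H.
Qed.

Lemma continuity_pt_of_is_derive (f : R -> R) (x d : R) :
  is_derive f x d -> continuity_pt f x.
Proof.
  intros H. apply derivable_continuous_pt. exists d. now apply is_derive_Reals.
Qed.

Lemma continuity_of_is_derive (f df : R -> R) :
  (forall x, is_derive f x (df x)) -> continuity f.
Proof. intros H x. eapply continuity_pt_of_is_derive, H. Qed.

Lemma continuity_pw_mult (k : R) (f : R -> R) :
  1 <= k -> continuity f -> continuity (fun s => pw s (k - 1) * f s).
Proof.
  intros Hk Hf x. apply continuity_pt_mult; [apply continuity_pt_pw; lra|apply Hf].
Qed.

Lemma continuity_cos_affine (x u : R) : continuity (fun s => cos (x * (u - s))).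
Proof.
  apply (continuity_of_is_derive _ (fun s => x * sin (x * (u - s)))).
  intros s. auto_derive; [trivial|]. unfold Rminus. ring.
Qed.

Lemma continuity_sin_affine (x u : R) : continuity (fun s => sin (x * (u - s))).
Proof.
  apply (continuity_of_is_derive _ (fun s => - x * cos (x * (u - s)))).
  intros s. auto_derive; [trivial|]. unfold Rminus. ring.
Qed.

(** Compare derivatives in the upper limit, with [f] fixed: [c * pw u k] is a primitive of
    [c k u^(k-1)]. *)
Lemma RInt_pw_mult_le (k : R) (f : R -> R) (u c : R) :
  1 <= k -> continuity f -> 0 <= u ->
  (forall s, 0 < s < u -> Rabs (f s) <= c) ->
  Rabs (k * RInt (fun s => pw s (k - 1) * f s) 0 u) <= c * pw u k.
Proof.
  intros Hk Hf Hu Hc.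
  pose proof (continuity_pw_mult k f Hk Hf) as Hcont.
  assert (D : forall b, is_derive (fun b => k * RInt (fun s => pw s (k - 1) * f s) 0 b) b
                          (k * (pw b (k - 1) * f b))).
  { intros b. apply (is_derive_scal (fun b => RInt (fun s => pw s (k - 1) * f s) 0 b)).
    now apply (is_derive_RInt_of_continuity (fun s => pw s (k - 1) * f s)). }
  pose proof (Rabs_diff_le_of_derive
    (fun b => k * RInt (fun s => pw s (k - 1) * f s) 0 b) (fun b => c * pw b k)
    (fun b => k * (pw b (k - 1) * f b)) (fun b => c * (k * pw b (k - 1))) 0 u Hu) as H.
  simpl in H. rewrite RInt_point, (pw_nonpos_base 0) in H by lra.
  unfold zero in H; simpl in H.
  rewrite !Rmult_0_r, !Rminus_0_r in H. apply H.
  - intros x _. eapply continuity_pt_of_is_derive, D.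
  - intros x _. apply (continuity_pt_scal (fun b => pw b k)). apply continuity_pt_pw. lra.
  - intros x _. apply D.
  - intros x Hx. apply (is_derive_scal (fun b => pw b k)). apply is_derive_pw. lra.
  - intros x Hx. rewrite !Rabs_mult. rewrite (Rabs_pos_eq k), (Rabs_pos_eq (pw _ _)).
    + specialize (Hc x Hx). pose proof (pw_ge0 x (k - 1)).
      assert (0 <= k * pw x (k - 1)) by (apply Rmult_le_pos; lra). nra.
    + apply pw_ge0.
    + lra.
Qed.

Lemma RInt_pw (k u : R) :
  1 <= k -> 0 <= u -> k * RInt (fun s => pw s (k - 1)) 0 u = pw u k.
Proof.
  intros Hk Hu.
  assert (Hcont : continuity (fun s => pw s (k - 1))).
  { intros x. apply continuity_pt_pw. lra. }
  pose proof (eq_of_derive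
    (fun b => k * RInt (fun s => pw s (k - 1)) 0 b) (fun b => pw b k)
    (fun b => k * pw b (k - 1)) 0 u Hu) as H.
  simpl in H. rewrite RInt_point, (pw_nonpos_base 0) in H by lra.
  unfold zero in H; simpl in H. rewrite Rmult_0_r, !Rminus_0_r in H.
  assert (D : forall b, is_derive (fun b => k * RInt (fun s => pw s (k - 1)) 0 b) b
                          (k * pw b (k - 1))).
  { intros b. apply (is_derive_scal (fun b => RInt (fun s => pw s (k - 1)) 0 b)).
    now apply (is_derive_RInt_of_continuity (fun s => pw s (k - 1))). }
  apply H.
  - intros x _. eapply continuity_pt_of_is_derive, D.
  - intros x _. apply continuity_pt_pw. lra.
  - intros x _. apply D.
  - intros x Hx. apply is_derive_pw. lra.
Qed.

(* [u^k * young k (x u)], see [young_scale]; the fractional integral of order [k] of [cos (x .)],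
   up to the factor [Gamma (k + 1)]. *)
Definition young_cos (k x u : R) : R :=
  k * RInt (fun s => pw s (k - 1) * cos (x * (u - s))) 0 u.

Definition young_sin (k x u : R) : R :=
  k * RInt (fun s => pw s (k - 1) * sin (x * (u - s))) 0 u.

(** The substitution [t = x (u - s)] turns [1 - t / (x u)] into [s / u]. For [x = 0] the value of
    [young] at [0] is the convention [1], which matches the integral of [k s^(k-1)]. *)
Lemma young_scale (k x u : R) :
  1 <= k -> 0 <= x -> 0 < u -> young_cos k x u = pw u k * young k (x * u).
Proof.
  intros Hk Hx Hu. unfold young.
  destruct (Req_EM_T (x * u) 0) as [E|E].
  - assert (x = 0) as -> by nra. unfold young_cos.
    rewrite Rmult_1_r, <- (RInt_pw k u) by lra. f_equal. apply RInt_ext.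
    intros s _. rewrite Rmult_0_l, cos_0. apply Rmult_1_r.
  - assert (0 < x) by nra.
    set (f := fun t => pw (1 - t / (x * u)) (k - 1) * cos t).
    assert (Cf : continuity f).
    { intros t. unfold f. apply continuity_pt_mult.
      - apply (continuity_pt_comp (fun t => 1 - t / (x * u)) (fun y => pw y (k - 1))).
        + apply continuity_pt_of_is_derive with (d := - (1 / (x * u))).
          auto_derive; [trivial|]. field. lra.
        + apply continuity_pt_pw. lra.
      - apply continuity_cos. }
    (* The substitution has slope [- x], so it runs from [s = u] down to [s = 0], and the limits
       have to be swapped afterwards. *)
    pose proof (RInt_comp_lin (V := R_CompleteNormedModule) f (- x) (x * u) u 0) as H1.
    replace (- x * u + x * u) with 0 in H1 by ring.
    replace (- x * 0 + x * u) with (x * u) in H1 by ring.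
    rewrite <- H1 by now apply ex_RInt_of_continuity.
    rewrite <- opp_RInt_swap.
    2:{ apply ex_RInt_swap. apply (ex_RInt_comp_lin (V := R_NormedModule) f (- x) (x * u) u 0).
        replace (- x * u + x * u) with 0 by ring.
        replace (- x * 0 + x * u) with (x * u) by ring. now apply ex_RInt_of_continuity. }
    rewrite (RInt_ext (V := R_CompleteNormedModule) _
      (fun s => scal (- x / pw u (k - 1)) (pw s (k - 1) * cos (x * (u - s)))) 0 u).
    2:{ intros s _. unfold f, scal; simpl; unfold mult; simpl.
        replace (1 - (- x * s + x * u) / (x * u)) with (s * / u) by (field; lra).
        rewrite pw_mult by now apply Rinv_0_lt_compat.
        replace (pw (/ u) (k - 1)) with (/ pw u (k - 1)).
        - replace (- x * s + x * u) with (x * (u - s)) by ring. unfold Rdiv. ring.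
        - pose proof (pw_pos u (k - 1) Hu).
          apply Rmult_eq_reg_l with (pw u (k - 1)); [|lra].
          rewrite <- pw_mult by now apply Rinv_0_lt_compat.
          rewrite !Rinv_r, pw_base1 by lra. reflexivity. }
    rewrite (RInt_scal (V := R_CompleteNormedModule)).
    2:{ apply ex_RInt_of_continuity, continuity_pw_mult; [exact Hk|apply continuity_cos_affine]. }
    unfold young_cos, scal, opp; simpl; unfold mult; simpl.
    rewrite (pw_pred u k) by lra. field. split; [|lra].
    apply Rgt_not_eq, pw_pos, Hu.
Qed.

Lemma young_cos_0r (k x : R) : young_cos k x 0 = 0.
Proof. unfold young_cos. rewrite RInt_point. apply Rmult_0_r. Qed.

Lemma young_sin_0r (k x : R) : young_sin k x 0 = 0.
Proof. unfold young_sin. rewrite RInt_point. apply Rmult_0_r. Qed.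

Lemma young_at_0 (k : R) : young k 0 = 1.
Proof. unfold young. destruct (Req_EM_T 0 0); [reflexivity|lra]. Qed.

Lemma young_cos_0l (k u : R) : 1 <= k -> 0 <= u -> young_cos k 0 u = pw u k.
Proof.
  intros Hk [Hu|<-].
  - rewrite young_scale, Rmult_0_l, young_at_0 by lra. ring.
  - rewrite young_cos_0r, pw_nonpos_base by lra. reflexivity.
Qed.

Lemma young_cos_le (k x u : R) : 1 <= k -> 0 <= u -> Rabs (young_cos k x u) <= pw u k.
Proof.
  intros Hk Hu. rewrite <- (Rmult_1_l (pw u k)). apply RInt_pw_mult_le; auto.
  - apply continuity_cos_affine.
  - intros s _. apply Rabs_le, COS_bound.
Qed.

Lemma young_sin_le (k x u : R) : 1 <= k -> 0 <= u -> Rabs (young_sin k x u) <= pw u k.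
Proof.
  intros Hk Hu. rewrite <- (Rmult_1_l (pw u k)). apply RInt_pw_mult_le; auto.
  - apply continuity_sin_affine.
  - intros s _. apply Rabs_le, SIN_bound.
Qed.

Lemma Rabs_cos_minus_1_le (x : R) : 0 <= x -> Rabs (cos x - 1) <= x.
Proof.
  intros Hx. rewrite <- cos_0. rewrite <- (Rminus_0_r x) at 2.
  apply (Rabs_diff_le_of_derive cos (fun x => x) (fun x => - sin x) (fun _ => 1)); auto.
  - intros y _. apply continuity_cos.
  - intros y _. apply derivable_continuous_pt, derivable_pt_id.
  - intros y _. auto_derive; [trivial|ring].
  - intros y _. apply (is_derive_id (K := R_AbsRing)).
  - intros y _. rewrite Rabs_Ropp. apply Rabs_le, SIN_bound.
Qed.

Lemma young_cos_minus_le (k x u : R) : 1 <= k -> 0 <= x -> 0 <= u ->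
  Rabs (young_cos k x u - pw u k) <= x * u * pw u k.
Proof.
  intros Hk Hx Hu.
  replace (young_cos k x u - pw u k) with
    (k * RInt (fun s => pw s (k - 1) * (cos (x * (u - s)) - 1)) 0 u).
  - apply RInt_pw_mult_le; auto.
    + intros y. apply continuity_pt_minus; [apply continuity_cos_affine|].
      apply continuity_pt_const. intros ? ?; reflexivity.
    + intros s Hs. apply Rle_trans with (x * (u - s)).
      * apply Rabs_cos_minus_1_le. apply Rmult_le_pos; lra.
      * apply Rmult_le_compat_l; lra.
  - unfold young_cos. rewrite <- (RInt_pw k u) by assumption.
    rewrite <- Rmult_minus_distr_l. f_equal. symmetry.
    rewrite <- (RInt_minus (V := R_CompleteNormedModule)).
    + apply RInt_ext. intros s _. unfold minus, plus, opp; simpl. ring.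
    + apply ex_RInt_of_continuity, continuity_pw_mult; [exact Hk|apply continuity_cos_affine].
    + apply ex_RInt_of_continuity. intros y. apply continuity_pt_pw. lra.
Qed.

(* Integration by parts in disguise: [s^(k-2)] is singular at [0], so the boundary term is
   put on the left and only its derivative inside the open interval is used. *)
Lemma young_cos_decay (k u : R) : 1 <= k -> 0 <= u ->
  Rabs (young_cos k 1 u) <= k * pw u (k - 1).
Proof.
  intros Hk Hu.
  set (F := fun t => RInt (fun s => pw s (k - 1) * cos (1 * (u - s))) 0 t).
  assert (DF : forall t, is_derive F t (pw t (k - 1) * cos (1 * (u - t)))).
  { intros t. apply (is_derive_RInt_of_continuity (fun s => pw s (k - 1) * cos (1 * (u - s)))).
    apply continuity_pw_mult; [exact Hk|apply continuity_cos_affine]. }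
  pose proof (Rabs_diff_le_of_derive
    (fun t => F t + pw t (k - 1) * sin (1 * (u - t))) (fun t => pw t (k - 1))
    (fun t => (k - 1) * pw t (k - 1 - 1) * sin (1 * (u - t)))
    (fun t => (k - 1) * pw t (k - 1 - 1)) 0 u Hu) as H.
  simpl in H. rewrite Rminus_diag, Rmult_0_r, sin_0, Rmult_0_r, Rplus_0_r in H.
  assert (F0 : F 0 = 0) by (unfold F; apply (RInt_point (V := R_CompleteNormedModule))).
  rewrite F0 in H.
  unfold young_cos. fold (F u). rewrite Rabs_mult, (Rabs_pos_eq k) by lra.
  apply Rmult_le_compat_l; [lra|].
  (* The boundary term at [0] vanishes for [k > 1], but for [k = 1] it equals [sin u], because
     [pw 0 0 = 1]. The increment of [pw _ (k - 1)] is smaller by [pw 0 (k - 1)], which pays for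
     it. *)
  set (t0 := pw 0 (k - 1) * sin (1 * (u - 0))) in *.
  assert (Ht0 : Rabs t0 <= pw 0 (k - 1)).
  { unfold t0. rewrite Rabs_mult, Rabs_pos_eq by apply pw_ge0.
    rewrite <- (Rmult_1_r (pw 0 (k - 1))) at 2.
    apply Rmult_le_compat_l; [apply pw_ge0|]. apply Rabs_le, SIN_bound. }
  replace (F u) with ((F u - (0 + t0)) + t0) by ring.
  eapply Rle_trans; [apply Rabs_triang|].
  enough (Rabs (F u - (0 + t0)) <= pw u (k - 1) - pw 0 (k - 1)) by lra.
  apply H.
  - intros x _. apply continuity_pt_plus.
    + eapply continuity_pt_of_is_derive, DF.
    + apply continuity_pw_mult; [exact Hk|apply continuity_sin_affine].
  - intros x _. apply continuity_pt_pw. lra.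
  - intros x Hx.
    replace ((k - 1) * pw x (k - 1 - 1) * sin (1 * (u - x))) with
      (pw x (k - 1) * cos (1 * (u - x)) +
       ((k - 1) * pw x (k - 1 - 1) * sin (1 * (u - x)) +
        pw x (k - 1) * - cos (1 * (u - x)))) by ring.
    apply (is_derive_plus (V := R_NormedModule) F); [apply DF|].
    apply (is_derive_mult (K := R_AbsRing) (fun t => pw t (k - 1)) (fun t => sin (1 * (u - t)))).
    + apply is_derive_pw. lra.
    + auto_derive; [trivial|unfold Rminus; ring].
    + intros n m. apply Rmult_comm.
  - intros x Hx. apply is_derive_pw. lra.
  - intros x Hx. rewrite Rabs_mult.
    assert (0 <= (k - 1) * pw x (k - 1 - 1)) by (apply Rmult_le_pos; [lra|apply pw_ge0]).
    rewrite Rabs_pos_eq by assumption. rewrite <- Rmult_1_r.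
    apply Rmult_le_compat_l; [assumption|]. apply Rabs_le, SIN_bound.
Qed.

Lemma young_le_1 (k x : R) : 1 <= k -> 0 <= x -> Rabs (young k x) <= 1.
Proof.
  intros Hk [Hx|<-]; [|rewrite young_at_0, Rabs_R1; lra].
  pose proof (young_cos_le k 1 x Hk (Rlt_le _ _ Hx)) as H.
  pose proof (pw_pos x k Hx).
  rewrite young_scale, Rmult_1_l, Rabs_mult, Rabs_pos_eq in H by lra. nra.
Qed.

Lemma young_decay (k x : R) : 1 <= k -> 0 <= x -> Rabs (young k x) <= 2 * k / (1 + x).
Proof.
  intros Hk Hx. apply Rle_div_r; [lra|].
  pose proof (young_le_1 k x Hk Hx) as H1.
  enough (Rabs (young k x) * x <= k) by lra.
  destruct Hx as [Hx|<-]; [|lra].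
  pose proof (young_cos_decay k x Hk (Rlt_le _ _ Hx)) as H.
  pose proof (pw_pos x (k - 1) Hx).
  rewrite young_scale, Rmult_1_l, Rabs_mult, Rabs_pos_eq in H by (try apply pw_ge0; lra).
  rewrite (pw_pred x k) in H by lra.
  apply Rmult_le_reg_l with (pw x (k - 1)); [assumption|]. lra.
Qed.

Lemma young_minus_1_le (k x : R) : 1 <= k -> 0 <= x -> Rabs (young k x - 1) <= x.
Proof.
  intros Hk [Hx|<-]; [|rewrite young_at_0, Rminus_diag, Rabs_R0; lra].
  pose proof (young_cos_minus_le k 1 x Hk Rle_0_1 (Rlt_le _ _ Hx)) as H.
  pose proof (pw_pos x k Hx).
  rewrite young_scale, Rmult_1_l in H by lra.
  replace (pw x k * young k x - pw x k) with (pw x k * (young k x - 1)) in H by ring.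
  rewrite Rabs_mult, Rabs_pos_eq in H by lra.
  apply Rmult_le_reg_l with (pw x k); [assumption|]. lra.
Qed.

(** In [young_cos] and [young_sin] the variable [u] occurs both as a limit and inside the integrand.
    The addition formulas move it out of the integrand, so that no differentiation under the
    integral sign is required. *)
Lemma young_cos_sin_split (k x u : R) : 1 <= k ->
  let A := RInt (fun s => pw s (k - 1) * cos (x * (0 - s))) 0 u in
  let B := RInt (fun s => pw s (k - 1) * sin (x * (0 - s))) 0 u in
  young_cos k x u = k * (cos (x * u) * A - sin (x * u) * B) /\
  young_sin k x u = k * (sin (x * u) * A + cos (x * u) * B).
Proof.
  intros Hk A B.
  assert (EA : ex_RInt (fun s => pw s (k - 1) * cos (x * (0 - s))) 0 u).
  { apply ex_RInt_of_continuity, continuity_pw_mult; [exact Hk|apply continuity_cos_affine]. }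
  assert (EB : ex_RInt (fun s => pw s (k - 1) * sin (x * (0 - s))) 0 u).
  { apply ex_RInt_of_continuity, continuity_pw_mult; [exact Hk|apply continuity_sin_affine]. }
  unfold young_cos, young_sin.
  split; f_equal; unfold A, B;
    rewrite <- !(RInt_scal (V := R_CompleteNormedModule)
      (fun s => pw s (k - 1) * cos (x * (0 - s)))) by exact EA;
    rewrite <- !(RInt_scal (V := R_CompleteNormedModule)
      (fun s => pw s (k - 1) * sin (x * (0 - s)))) by exact EB.
  - rewrite <- (RInt_minus (V := R_CompleteNormedModule)).
    + apply RInt_ext. intros s _. unfold minus, plus, opp, scal; simpl; unfold mult; simpl.
      replace (x * (u - s)) with (x * u + x * (0 - s)) by ring. rewrite cos_plus. ring.
    + now apply (ex_RInt_scal (V := R_NormedModule)).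
    + now apply (ex_RInt_scal (V := R_NormedModule)).
  - rewrite <- (RInt_plus (V := R_CompleteNormedModule)).
    + apply RInt_ext. intros s _. unfold minus, plus, opp, scal; simpl; unfold mult; simpl.
      replace (x * (u - s)) with (x * u + x * (0 - s)) by ring. rewrite sin_plus. ring.
    + now apply (ex_RInt_scal (V := R_NormedModule)).
    + now apply (ex_RInt_scal (V := R_NormedModule)).
Qed.

(** Both functions are convolutions of [k s^(k-1)] with a trigonometric function; the derivative
    falls on the latter, and the boundary term [k u^(k-1)] appears only for the cosine since
    [sin 0 = 0]. *)
Lemma is_derive_young_cos_sin (k x u : R) : 1 <= k ->
  is_derive (young_cos k x) u (k * pw u (k - 1) - x * young_sin k x u) /\
  is_derive (young_sin k x) u (x * young_cos k x u).
Proof.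
  intros Hk.
  set (A := fun u => RInt (fun s => pw s (k - 1) * cos (x * (0 - s))) 0 u).
  set (B := fun u => RInt (fun s => pw s (k - 1) * sin (x * (0 - s))) 0 u).
  assert (DA : is_derive A u (pw u (k - 1) * cos (x * (0 - u)))).
  { apply (is_derive_RInt_of_continuity (fun s => pw s (k - 1) * cos (x * (0 - s)))).
    apply continuity_pw_mult; [exact Hk|apply continuity_cos_affine]. }
  assert (DB : is_derive B u (pw u (k - 1) * sin (x * (0 - u)))).
  { apply (is_derive_RInt_of_continuity (fun s => pw s (k - 1) * sin (x * (0 - s)))).
    apply continuity_pw_mult; [exact Hk|apply continuity_sin_affine]. }
  destruct (young_cos_sin_split k x u Hk) as [EC ES]. fold (A u) (B u) in EC, ES.
  assert (HA : ex_derive A u) by (eexists; exact DA).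
  assert (HB : ex_derive B u) by (eexists; exact DB).
  assert (Hcs : cos (x * u) * cos (x * u) + sin (x * u) * sin (x * u) = 1).
  { pose proof (sin2_cos2 (x * u)). unfold Rsqr in *. lra. }
  replace (x * (0 - u)) with (- (x * u)) in DA, DB by ring.
  rewrite cos_neg in DA. rewrite sin_neg in DB.
  split.
  - apply (is_derive_ext (fun u => k * (cos (x * u) * A u - sin (x * u) * B u))).
    + intros t. symmetry. exact (proj1 (young_cos_sin_split k x t Hk)).
    + auto_derive; [tauto|].
      replace (Derive (fun x => A x) u) with (pw u (k - 1) * cos (x * u))
        by (symmetry; now apply is_derive_unique).
      replace (Derive (fun x => B x) u) with (pw u (k - 1) * - sin (x * u))
        by (symmetry; now apply is_derive_unique).
      rewrite ES.
      replace (k * pw u (k - 1)) with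
        (k * pw u (k - 1) * (cos (x * u) * cos (x * u) + sin (x * u) * sin (x * u)))
        by (rewrite Hcs; ring). ring.
  - apply (is_derive_ext (fun u => k * (sin (x * u) * A u + cos (x * u) * B u))).
    + intros t. symmetry. exact (proj2 (young_cos_sin_split k x t Hk)).
    + auto_derive; [tauto|].
      replace (Derive (fun x => A x) u) with (pw u (k - 1) * cos (x * u))
        by (symmetry; now apply is_derive_unique).
      replace (Derive (fun x => B x) u) with (pw u (k - 1) * - sin (x * u))
        by (symmetry; now apply is_derive_unique).
      rewrite EC. ring.
Qed.

Lemma continuity_young_cos (k x : R) : 1 <= k -> continuity (young_cos k x).
Proof.
  intros Hk u. exact (continuity_pt_of_is_derive _ _ _ (proj1 (is_derive_young_cos_sin k x u Hk))).
Qed.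

Lemma continuity_pt_young (k x : R) : 1 <= k -> 0 < x -> continuity_pt (young k) x.
Proof.
  intros Hk Hx. apply (continuity_pt_ext_loc (fun y => young_cos k 1 y / pw y k)).
  - exists (mkposreal x Hx). intros y Hy.
    apply Rabs_lt_between in Hy. change (- x < y - x < x) in Hy.
    assert (Hy0 : 0 < y) by lra. rewrite young_scale, Rmult_1_l by lra.
    field. apply Rgt_not_eq, pw_pos, Hy0.
  - apply continuity_pt_div.
    + now apply continuity_young_cos.
    + apply continuity_pt_pw. lra.
    + apply Rgt_not_eq, pw_pos, Hx.
Qed.

Lemma continuity_exp_opp : continuity (fun u => exp (- u)).
Proof.
  apply (continuity_of_is_derive _ (fun u => - exp (- u))).
  intros u. auto_derive; [trivial|ring].
Qed.

(* The Laplace transform of [young_cos k x] is that of [u^(k-1)] times that of [cos (x .)], namely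
   [1 / (1 + x^2)]; truncated at [r], the product rule leaves an exponentially small boundary term. *)
Lemma laplace_young_cos (k x r : R) : 1 <= k -> 0 <= r ->
  (1 + x * x) * RInt (fun u => exp (- u) * young_cos k x u) 0 r =
  k * RInt (fun u => exp (- u) * pw u (k - 1)) 0 r
  + exp (- r) * (x * young_sin k x r - young_cos k x r).
Proof.
  intros Hk Hr.
  assert (C1 : continuity (fun u => exp (- u) * young_cos k x u)).
  { intros u. apply continuity_pt_mult; [apply continuity_exp_opp|now apply continuity_young_cos]. }
  assert (C2 : continuity (fun u => exp (- u) * pw u (k - 1))).
  { intros u. apply continuity_pt_mult; [apply continuity_exp_opp|apply continuity_pt_pw; lra]. }
  set (I1 := fun r => RInt (fun u => exp (- u) * young_cos k x u) 0 r).
  set (I2 := fun r => RInt (fun u => exp (- u) * pw u (k - 1)) 0 r).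
  assert (D1 : forall u, is_derive I1 u (exp (- u) * young_cos k x u)).
  { intros u. now apply (is_derive_RInt_of_continuity (fun u => exp (- u) * young_cos k x u)). }
  assert (D2 : forall u, is_derive I2 u (exp (- u) * pw u (k - 1))).
  { intros u. now apply (is_derive_RInt_of_continuity (fun u => exp (- u) * pw u (k - 1))). }
  set (f := fun r => (1 + x * x) * I1 r).
  set (g := fun r => k * I2 r + exp (- r) * (x * young_sin k x r - young_cos k x r)).
  assert (Df : forall u, is_derive f u ((1 + x * x) * (exp (- u) * young_cos k x u))).
  { intros u. apply (is_derive_scal I1), D1. }
  assert (Dg : forall u, is_derive g u ((1 + x * x) * (exp (- u) * young_cos k x u))).
  { intros u. destruct (is_derive_young_cos_sin k x u Hk) as [DC DS].
    unfold g. auto_derive.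
    - repeat split; [exists (exp (- u) * pw u (k - 1)); apply D2
                    |eexists; exact DS|eexists; exact DC].
    - replace (Derive (fun x => I2 x) u) with (exp (- u) * pw u (k - 1))
        by (symmetry; apply is_derive_unique, D2).
      replace (Derive (fun x0 => young_cos k x x0) u) with (k * pw u (k - 1) - x * young_sin k x u)
        by (symmetry; apply is_derive_unique, DC).
      replace (Derive (fun x0 => young_sin k x x0) u) with (x * young_cos k x u)
        by (symmetry; apply is_derive_unique, DS).
      ring. }
  pose proof (eq_of_derive f g _ 0 r Hr
    (fun u _ => continuity_of_is_derive f _ Df u)
    (fun u _ => continuity_of_is_derive g _ Dg u)
    (fun u _ => Df u) (fun u _ => Dg u)) as H.
  unfold f, g, I1, I2 in H. rewrite !RInt_point, young_cos_0r, young_sin_0r in H.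
  unfold zero in H; simpl in H. unfold I1, I2. lra.
Qed.

(** Subtracting the identities of [laplace_young_cos] at [x] and at [0] cancels the main integrals
    and leaves [exp (- r) (x S + (P - C)) / (1 + x^2)] with [|S| <= P = r^k]. Near [x = 0] one uses
    [|C - P| <= x r P], for large [x] one uses [|C - P| <= 2 P]. Bounds by [B x] and by [B / x] are
    the form in which [weight_ge] consumes an error. *)
Lemma young_mean_approx (k x r : R) : 1 <= k -> 0 <= x -> 1 <= r ->
  let d := Rabs (RInt (fun u => exp (- u) * young_cos k x u) 0 r -
                 RInt (fun u => exp (- u) * young_cos k 0 u) 0 r * (/ (1 + x * x))) in
  let B := exp (- r) * pw r k * (1 + r) in
  d <= B * x /\ d * x <= B.
Proof.
  intros Hk Hx Hr d B.
  assert (Hv : 0 < / (1 + x * x)) by (apply Rinv_0_lt_compat; nra).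
  assert (Hv1 : / (1 + x * x) * (1 + x * x) = 1) by (apply Rinv_l; nra).
  pose proof (laplace_young_cos k x r Hk ltac:(lra)) as Ex.
  pose proof (laplace_young_cos k 0 r Hk ltac:(lra)) as E0.
  rewrite (young_cos_0l k r) in E0 by lra.
  set (C := young_cos k x r) in *. set (S := young_sin k x r) in *.
  set (P := pw r k) in *.
  pose proof (young_cos_le k x r Hk ltac:(lra)) as BC. fold C P in BC.
  pose proof (young_sin_le k x r Hk ltac:(lra)) as BS. fold S P in BS.
  pose proof (young_cos_minus_le k x r Hk Hx ltac:(lra)) as BCP. fold C P in BCP.
  set (Ax := RInt (fun u => exp (- u) * young_cos k x u) 0 r) in *.
  set (A0 := RInt (fun u => exp (- u) * young_cos k 0 u) 0 r) in *.
  pose proof (exp_pos (- r)) as He. pose proof (pw_ge0 r k) as HP. fold P in HP.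
  assert (Ed : d = exp (- r) * (/ (1 + x * x) * Rabs (x * S + (P - C)))).
  { unfold d.
    replace (Ax - A0 * / (1 + x * x)) with (exp (- r) * (/ (1 + x * x) * (x * S + (P - C)))).
    - rewrite !Rabs_mult, (Rabs_pos_eq (exp _)), (Rabs_pos_eq (/ _)) by lra. reflexivity.
    - apply Rmult_eq_reg_l with (1 + x * x); [|nra].
      replace ((1 + x * x) * (exp (- r) * (/ (1 + x * x) * (x * S + (P - C))))) with
        (/ (1 + x * x) * (1 + x * x) * (exp (- r) * (x * S + (P - C)))) by ring.
      replace ((1 + x * x) * (Ax - A0 * / (1 + x * x))) with
        ((1 + x * x) * Ax - / (1 + x * x) * (1 + x * x) * A0) by ring.
      rewrite Hv1. lra. }
  assert (Hs : Rabs (x * S + (P - C)) <= x * P + Rabs (C - P)).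
  { eapply Rle_trans; [apply Rabs_triang|]. rewrite (Rabs_minus_sym P C), Rabs_mult.
    rewrite (Rabs_pos_eq x) by exact Hx. apply Rplus_le_compat_r.
    apply Rmult_le_compat_l; assumption. }
  assert (H2 : Rabs (C - P) <= 2 * P).
  { eapply Rle_trans; [apply Rabs_triang|]. rewrite Rabs_Ropp, (Rabs_pos_eq P) by exact HP. lra. }
  assert (Hv2 : / (1 + x * x) <= 1) by nra.
  rewrite Ed. unfold B. set (v := / (1 + x * x)) in *. set (z := Rabs (x * S + (P - C))) in *.
  assert (Hz0 : 0 <= z) by apply Rabs_pos.
  split.
  - replace (exp (- r) * P * (1 + r) * x) with (exp (- r) * (x * P + x * r * P)) by ring.
    apply Rmult_le_compat_l; [lra|].
    apply Rle_trans with (1 * z); [apply Rmult_le_compat_r; assumption|]. lra.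
  - rewrite !Rmult_assoc. apply Rmult_le_compat_l; [lra|].
    apply Rle_trans with (v * ((x * P + 2 * P) * x)).
    { apply Rmult_le_compat_l; [lra|]. apply Rmult_le_compat_r; lra. }
    apply Rle_trans with (v * (2 * (1 + x * x) * P)).
    { apply Rmult_le_compat_l; [lra|].
      assert (0 <= ((x - 1) * (x - 1) + 1) * P) by (apply Rmult_le_pos; nra). nra. }
    replace (v * (2 * (1 + x * x) * P)) with (v * (1 + x * x) * (2 * P)) by ring.
    rewrite Hv1. nra.
Qed.

(** Keeps the total mass of the truncated averages away from [0] uniformly in [r], so that they can
    be normalised; the mass on [[0, 1]] serves as lower bound. *)
Lemma RInt_pos_lower_bound (f : R -> R) :
  continuity f -> (forall u, 0 < u -> 0 < f u) ->
  exists c, 0 < c /\ forall r, 1 <= r -> c <= RInt f 0 r.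
Proof.
  intros Cf Hf. exists (RInt f 0 1). split.
  - apply RInt_gt_0; [lra| |].
    + intros x Hx. apply Hf. lra.
    + intros x _. apply continuous_of_continuity_pt, Cf.
  - intros r Hr.
    rewrite <- (RInt_Chasles (V := R_CompleteNormedModule) f 0 1 r)
      by now apply ex_RInt_of_continuity.
    enough (0 <= RInt f 1 r) by (unfold plus; simpl; lra).
    apply RInt_ge_0; [exact Hr|now apply ex_RInt_of_continuity|].
    intros x Hx. left. apply Hf. lra.
Qed.

Lemma continuity_exp_pw_shift (b y : R) :
  0 < b -> continuity (fun u => exp (- u) * pw (u - y) b).
Proof.
  intros Hb u. apply continuity_pt_mult; [apply continuity_exp_opp|].
  apply (continuity_pt_comp (fun u => u - y) (fun z => pw z b)).
  - apply continuity_pt_of_is_derive with (d := 1). auto_derive; [trivial|ring].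
  - apply continuity_pt_pw. lra.
Qed.

(** Without truncation, shifting [u] by [x] would give equality, because [pw (u - x) b] vanishes for
    [u < x]. If [r <= x], the first integral is [0] and the error is at most [x^(b+1) exp (- x)]. If
    [x < r], the shift leaves the piece over [[r - x, r]], of size at most [x r^b exp (- r)] after
    multiplication by [exp (- x)]. The bound [B] for [y^(b+3) exp (- y)] leaves a spare factor
    [1 / r] in both cases. *)
Lemma riesz_mean_approx (b x r B : R) : 0 < b -> 0 <= x -> 1 <= r ->
  (forall y, 0 < y -> pw y (b + 2) * exp (- y) * y <= B) ->
  let d := Rabs (RInt (fun u => exp (- u) * pw (u - x) b) 0 r -
                 RInt (fun u => exp (- u) * pw (u - 0) b) 0 r * exp (- x)) in
  d <= B / r * x /\ d * x <= B / r.
Proof.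
  intros Hb Hx Hr HB d.
  assert (Hc : forall y, continuity (fun u => exp (- u) * pw (u - y) b)).
  { intros y. now apply continuity_exp_pw_shift. }
  assert (HBy : forall y, 0 < y -> pw y b * (y * y) * exp (- y) <= B / y).
  { intros y Hy. apply le_div_of_mult; [exact Hy|]. specialize (HB y Hy).
    rewrite pw_pred in HB by lra. replace (b + 2 - 1) with (b + 1) in HB by ring.
    rewrite pw_pred in HB by lra. replace (b + 1 - 1) with b in HB by ring. lra. }
  set (F := fun u => exp (- u) * pw (u - 0) b) in *.
  assert (CF : continuity F) by apply Hc.
  assert (F0 : forall u, 0 <= F u) by (intros u; apply Rmult_le_pos; [left; apply exp_pos|apply pw_ge0]).
  destruct (Rle_dec r x) as [Hrx|Hrx].
  - assert (Ed : d = RInt F 0 r * exp (- x)).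
    { unfold d. rewrite (RInt_ext _ (fun _ => 0)).
      - rewrite RInt_const. unfold scal; simpl; unfold mult; simpl.
        rewrite Rmult_0_r, Rminus_0_l, Rabs_Ropp. apply Rabs_pos_eq.
        apply Rmult_le_pos; [|left; apply exp_pos].
        apply RInt_ge_0; [lra|now apply ex_RInt_of_continuity|]. intros; apply F0.
      - intros u. rewrite Rmin_left, Rmax_right by lra. intros Hu.
        rewrite pw_nonpos_base by lra. apply Rmult_0_r. }
    assert (HI : RInt F 0 r <= x * pw x b).
    { apply Rle_trans with (Rabs (RInt F 0 r)); [apply Rle_abs|].
      apply Rle_trans with ((r - 0) * pw r b).
      - apply abs_RInt_le_const; [lra|now apply ex_RInt_of_continuity|].
        intros u Hu. rewrite Rabs_pos_eq by apply F0. unfold F.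
        rewrite <- Rmult_1_l. apply Rmult_le_compat; [left; apply exp_pos|apply pw_ge0| |].
        + rewrite <- exp_0. destruct (Req_dec u 0) as [->|]; [rewrite Ropp_0; lra|].
          left. apply exp_increasing. lra.
        + apply pw_le; lra.
      - apply Rmult_le_compat; [lra|apply pw_ge0|lra|]. apply pw_le; lra. }
    assert (Hdx : d * x <= B / r).
    { rewrite Ed. apply Rle_trans with (x * pw x b * exp (- x) * x).
      - apply Rmult_le_compat_r; [exact Hx|]. apply Rmult_le_compat_r; [left; apply exp_pos|exact HI].
      - specialize (HBy x ltac:(lra)). apply Rle_trans with (B / x); [lra|].
        assert (HB0 : 0 <= B).
        { eapply Rle_trans; [|apply (HB 1); lra]. rewrite Rmult_1_r.
          apply Rmult_le_pos; [apply pw_ge0|left; apply exp_pos]. }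
        unfold Rdiv. apply Rmult_le_compat_l; [exact HB0|]. apply Rinv_le_contravar; lra. }
    split; [|exact Hdx].
    assert (Hd0 : 0 <= d) by apply Rabs_pos.
    assert (Hx1 : 1 <= x) by lra.
    apply Rle_trans with (d * x); [nra|]. apply Rle_trans with (B / r); [exact Hdx|].
    assert (0 <= d * x) by now apply Rmult_le_pos.
    rewrite <- (Rmult_1_r (B / r)) at 1. apply Rmult_le_compat_l; lra.
  - assert (Hshift : RInt (fun u => exp (- u) * pw (u - x) b) 0 r = exp (- x) * RInt F 0 (r - x)).
    { rewrite <- (RInt_Chasles (V := R_CompleteNormedModule) _ 0 x r)
        by (apply ex_RInt_of_continuity, Hc).
      rewrite (RInt_ext _ (fun _ => 0) 0 x).
      2:{ intros u. rewrite Rmin_left, Rmax_right by lra. intros Hu.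
          rewrite pw_nonpos_base by lra. apply Rmult_0_r. }
      rewrite RInt_const.
      pose proof (RInt_comp_lin (V := R_CompleteNormedModule)
        (fun u => exp (- u) * pw (u - x) b) 1 x 0 (r - x)) as H1.
      replace (1 * 0 + x) with x in H1 by ring.
      replace (1 * (r - x) + x) with r in H1 by ring.
      rewrite <- H1 by (apply ex_RInt_of_continuity, Hc).
      transitivity (RInt (fun u => exp (- x) * F u) 0 (r - x)).
      - unfold scal, plus; simpl; unfold mult; simpl. rewrite Rmult_0_r, Rplus_0_l.
        apply RInt_ext. intros u _. unfold F.
        replace (1 * u + x - x) with (u - 0) by ring.
        replace (- (1 * u + x)) with (- x + - u) by ring. rewrite exp_plus.
        apply Rminus_diag_uniq. ring.
      - apply (RInt_scal (V := R_CompleteNormedModule) F). now apply ex_RInt_of_continuity. }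
    assert (Htail : 0 <= RInt F (r - x) r <= x * (exp (- (r - x)) * pw r b)).
    { split.
      - apply RInt_ge_0; [lra|now apply ex_RInt_of_continuity|]. intros; apply F0.
      - apply Rle_trans with (Rabs (RInt F (r - x) r)); [apply Rle_abs|].
        replace x with (r - (r - x)) at 2 by ring.
        apply abs_RInt_le_const; [lra|now apply ex_RInt_of_continuity|].
        intros u Hu. rewrite Rabs_pos_eq by apply F0. unfold F.
        apply Rmult_le_compat; [left; apply exp_pos|apply pw_ge0| |].
        + destruct (Req_dec u (r - x)) as [->|]; [lra|]. left. apply exp_increasing. lra.
        + apply pw_le; lra. }
    assert (Ed : d = exp (- x) * RInt F (r - x) r).
    { unfold d. rewrite Hshift.
      rewrite <- (RInt_Chasles (V := R_CompleteNormedModule) F 0 (r - x) r)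
        by now apply ex_RInt_of_continuity.
      unfold plus; simpl.
      replace (exp (- x) * RInt F 0 (r - x) - (RInt F 0 (r - x) + RInt F (r - x) r) * exp (- x))
        with (- (exp (- x) * RInt F (r - x) r)) by ring.
      rewrite Rabs_Ropp, Rabs_pos_eq; [reflexivity|].
      apply Rmult_le_pos; [left; apply exp_pos|apply Htail]. }
    assert (Hd : d <= x * (exp (- r) * pw r b)).
    { rewrite Ed. apply Rle_trans with (exp (- x) * (x * (exp (- (r - x)) * pw r b))).
      - apply Rmult_le_compat_l; [left; apply exp_pos|apply Htail].
      - right. replace (- r) with (- x + - (r - x)) by ring. rewrite exp_plus. ring. }
    specialize (HBy r ltac:(lra)).
    assert (He : 0 <= exp (- r) * pw r b).
    { apply Rmult_le_pos; [left; apply exp_pos|apply pw_ge0]. }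
    assert (Hr2 : exp (- r) * pw r b <= B / r).
    { apply Rle_trans with (pw r b * (r * r) * exp (- r)); [|exact HBy].
      assert (1 <= r * r) by nra. nra. }
    split.
    + apply Rle_trans with (x * (exp (- r) * pw r b)); [exact Hd|]. nra.
    + apply Rle_trans with (x * (exp (- r) * pw r b) * x).
      * apply Rmult_le_compat_r; assumption.
      * eapply Rle_trans; [|exact HBy].
        assert (x * x <= r * r) by nra. nra.
Qed.

(** * Bernstein polynomials *)

(* The mean of [g] under the binomial law with parameters [n] and [x]; as a function of [x] it is
   the Bernstein polynomial with node values [g 0, ..., g n]. *)
Fixpoint binomial_mean (n : nat) (x : R) (g : nat -> R) : R :=
  match n with
  | O => g O
  | S n' => x * binomial_mean n' x (fun k => g (S k)) + (1 - x) * binomial_mean n' x g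
  end.

Lemma binomial_mean_le (n : nat) (x : R) (g g' : nat -> R) :
  0 <= x <= 1 -> (forall k, (k <= n)%nat -> g k <= g' k) ->
  binomial_mean n x g <= binomial_mean n x g'.
Proof.
  intros Hx. revert g g'. induction n as [|n IH]; intros g g' H; simpl.
  - now apply H.
  - apply Rplus_le_compat; apply Rmult_le_compat_l; try lra; apply IH;
      intros k Hk; apply H; lia.
Qed.

Lemma binomial_mean_ext (n : nat) (x : R) (g g' : nat -> R) :
  (forall k, g k = g' k) -> binomial_mean n x g = binomial_mean n x g'.
Proof.
  revert g g'. induction n as [|n IH]; intros g g' H; simpl; [apply H|].
  rewrite (IH (fun k => g (S k)) (fun k => g' (S k))), (IH g g'); auto.
Qed.

(** Variance plus squared bias about [c]. The centre must stay general in the induction: a success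
    shifts [k] by one, hence [c] to [c - 1]. *)
Lemma binomial_mean_quadratic (n : nat) (x a b c : R) :
  binomial_mean n x (fun k => a + b * (INR k - c) ^ 2) =
  a + b * (INR n * x * (1 - x) + (INR n * x - c) ^ 2).
Proof.
  revert c. induction n as [|n IH]; intros c.
  - simpl. ring.
  - cbn [binomial_mean]. rewrite IH.
    rewrite (binomial_mean_ext n x _ (fun k => a + b * (INR k - (c - 1)) ^ 2)).
    + rewrite IH, S_INR. ring.
    + intros k. rewrite S_INR. ring.
Qed.

Lemma bernstein_error (q : R -> R) (eps B : R) (n : nat) (x : R) :
  (0 < n)%nat -> 0 <= B -> 0 <= x <= 1 ->
  (forall s t, 0 <= s <= 1 -> 0 <= t <= 1 -> Rabs (q s - q t) <= eps + B * (s - t) ^ 2) ->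
  Rabs (q x - binomial_mean n x (fun k => q (INR k / INR n))) <= eps + B / INR n.
Proof.
  intros Hn HB Hx Hq.
  assert (Hn0 : 0 < INR n) by (apply (lt_INR 0); exact Hn).
  assert (Hnode : forall k, (k <= n)%nat -> 0 <= INR k / INR n <= 1).
  { intros k Hk. pose proof (pos_INR k). split.
    - apply Rdiv_le_0_compat; lra.
    - apply Rle_div_l; [lra|]. rewrite Rmult_1_l. now apply le_INR. }
  assert (Hvar : B / INR n ^ 2 * (INR n * x * (1 - x) + (INR n * x - INR n * x) ^ 2)
                 <= B / INR n).
  { replace (B / INR n ^ 2 * (INR n * x * (1 - x) + (INR n * x - INR n * x) ^ 2))
      with (B / INR n * (x * (1 - x))) by (field; lra).
    rewrite <- Rmult_1_r. apply Rmult_le_compat_l; [apply Rdiv_le_0_compat; lra|]. nra. }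
  assert (Hsq : forall k, B / INR n ^ 2 * (INR k - INR n * x) ^ 2 = B * (x - INR k / INR n) ^ 2).
  { intros k. field. lra. }
  apply Rabs_le. split.
  - enough (binomial_mean n x (fun k => q (INR k / INR n)) <=
      (q x + eps) + B / INR n ^ 2 * (INR n * x * (1 - x) + (INR n * x - INR n * x) ^ 2)) by lra.
    rewrite <- binomial_mean_quadratic. apply binomial_mean_le; [exact Hx|].
    intros k Hk. rewrite Hsq. specialize (Hq x (INR k / INR n) Hx (Hnode k Hk)).
    apply Rabs_le_between in Hq. lra.
  - enough ((q x - eps) + - (B / INR n ^ 2) * (INR n * x * (1 - x) + (INR n * x - INR n * x) ^ 2)
      <= binomial_mean n x (fun k => q (INR k / INR n))) by lra.
    rewrite <- binomial_mean_quadratic. apply binomial_mean_le; [exact Hx|].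
    intros k Hk. rewrite Ropp_mult_distr_l_reverse, Hsq.
    specialize (Hq x (INR k / INR n) Hx (Hnode k Hk)).
    apply Rabs_le_between in Hq. lra.
Qed.

(** Uniform continuity handles [|s - t| < d]; otherwise [|q s - q t| <= 2 M <= 2 M (s - t)^2 / d^2].
    A quadratic majorant suits Bernstein polynomials because its binomial mean is explicit, so the
    nodes need not be split into near and far ones. *)
Lemma quadratic_modulus (q : R -> R) (eps : R) :
  (forall x, 0 <= x <= 1 -> continuity_pt q x) -> 0 < eps ->
  exists B, 0 <= B /\ forall s t, 0 <= s <= 1 -> 0 <= t <= 1 ->
    Rabs (q s - q t) <= eps + B * (s - t) ^ 2.
Proof.
  intros Hc Heps.
  destruct (Heine q (fun c => 0 <= c <= 1) (compact_P3 0 1) Hc (mkposreal eps Heps)) as [d Hd].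
  destruct (bounded_continuity (V := R_NormedModule) q 0 1) as [M HM].
  { intros x Hx. apply continuity_pt_filterlim. now apply Hc. }
  assert (HM0 : 0 < M).
  { eapply Rle_lt_trans; [|apply (HM 0); lra]. apply norm_ge_0. }
  exists (2 * M / (d * d)). pose proof (cond_pos d) as Hd0.
  assert (HB : 0 <= 2 * M / (d * d)) by (apply Rdiv_le_0_compat; nra).
  split; [exact HB|]. intros s t Hs Ht.
  destruct (Rlt_dec (Rabs (s - t)) d) as [H|H].
  - specialize (Hd s t Hs Ht H). simpl in Hd. pose proof (pow2_ge_0 (s - t)). nra.
  - pose proof (HM s Hs) as H1. pose proof (HM t Ht) as H2.
    change (Rabs (q s) < M) in H1. change (Rabs (q t) < M) in H2.
    assert (Rabs (q s - q t) <= 2 * M).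
    { eapply Rle_trans; [apply Rabs_triang|]. rewrite Rabs_Ropp. lra. }
    assert (2 * M <= 2 * M / (d * d) * (s - t) ^ 2).
    { replace (2 * M / (d * d) * (s - t) ^ 2) with (2 * M * ((s - t) ^ 2 / (d * d)))
        by (field; lra).
      rewrite <- (Rmult_1_r (2 * M)) at 1.
      apply Rmult_le_compat_l; [lra|]. apply Rle_div_r; [nra|].
      rewrite Rmult_1_l, <- (pow2_abs (s - t)). nra. }
    lra.
Qed.

Lemma weierstrass (q : R -> R) (eps : R) :
  (forall x, 0 <= x <= 1 -> continuity_pt q x) -> 0 < eps ->
  exists n g, forall x, 0 <= x <= 1 -> Rabs (q x - binomial_mean n x g) <= eps.
Proof.
  intros Hc Heps.
  destruct (quadratic_modulus q (eps / 2) Hc ltac:(lra)) as (B & HB & Hq).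
  destruct (INR_unbounded (2 * B / eps)) as [n Hn].
  exists (S n), (fun k => q (INR k / INR (S n))). intros x Hx.
  eapply Rle_trans; [apply (bernstein_error q (eps / 2) B); auto; lia|].
  assert (H0 : 0 <= 2 * B / eps) by (apply Rdiv_le_0_compat; lra).
  enough (B / INR (S n) <= eps / 2) by lra.
  rewrite S_INR. apply Rle_div_l; [lra|].
  apply Rlt_div_l in Hn; [|lra]. lra.
Qed.

(** * Means of a series with respect to a kernel *)

Lemma ex_series_of_bounded (u : nat -> R) (K : R) :
  (forall n, 0 <= u n) -> (forall n, sum_n u n <= K) -> ex_series u /\ Series u <= K.
Proof.
  intros H0 HK.
  assert (E : ex_series u).
  { destruct (ex_finite_lim_seq_incr (sum_n u) K) as [s Hs].
    - intros n. rewrite sum_Sn. unfold plus; simpl. specialize (H0 (S n)). lra.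
    - exact HK.
    - exists s. exact Hs. }
  split; [exact E|].
  assert (L : is_lim_seq (sum_n u) (Series u)) by apply (Series_correct u E).
  exact (is_lim_seq_le _ _ _ _ HK L (is_lim_seq_const K)).
Qed.

Lemma Series_dominated (u v : nat -> R) :
  (forall n, Rabs (u n) <= v n) -> ex_series v -> ex_series u /\ Rabs (Series u) <= Series v.
Proof.
  intros H Ev.
  assert (Eu : ex_series (fun n => Rabs (u n))).
  { apply (ex_series_le (K := R_AbsRing) (V := R_CompleteNormedModule) _ v); [|exact Ev].
    intros n. unfold norm; simpl. unfold abs; simpl. rewrite Rabs_Rabsolu. apply H. }
  split; [now apply ex_series_Rabs|].
  eapply Rle_trans; [now apply Series_Rabs|]. apply Series_le; [|exact Ev].
  intros n. split; [apply Rabs_pos|apply H].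
Qed.

(** The weak inequality in the conclusion lets bounds survive the passage from partial sums to
    series. *)
Definition lim0 (f : R -> R) (y : R) : Prop :=
  forall eps, 0 < eps -> exists d, 0 < d /\ forall h, 0 < h < d -> Rabs (f h - y) <= eps.

Lemma lim0_filterlim (f : R -> R) (y : R) :
  lim0 f y <-> filterlim f (at_right 0) (locally y).
Proof.
  split.
  - intros H P [e HP]. pose proof (cond_pos e).
    destruct (H (e / 2) ltac:(lra)) as (d & Hd & Hf).
    exists (mkposreal d Hd). intros h Hh Hh0. apply HP.
    change (Rabs (f h - y) < e).
    apply Rle_lt_trans with (e / 2); [|lra]. apply Hf. split; [exact Hh0|].
    change (Rabs (h - 0) < d) in Hh. rewrite Rminus_0_r, Rabs_pos_eq in Hh; lra.
  - intros H e He.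
    destruct (H (fun z => Rabs (z - y) < e)) as [d Hd].
    { exists (mkposreal e He). intros z Hz. exact Hz. }
    exists d. split; [apply cond_pos|]. intros h Hh. apply Rlt_le, Hd; [|apply Hh].
    change (Rabs (h - 0) < d). rewrite Rminus_0_r, Rabs_pos_eq; lra.
Qed.

Lemma lim0_ext (f g : R -> R) (y : R) :
  (forall h, 0 < h -> f h = g h) -> lim0 f y -> lim0 g y.
Proof.
  intros E H e He. destruct (H e He) as (d & Hd & Hf). exists d. split; [exact Hd|].
  intros h Hh. rewrite <- E by lra. now apply Hf.
Qed.

Lemma lim0_plus (f g : R -> R) (y z : R) :
  lim0 f y -> lim0 g z -> lim0 (fun h => f h + g h) (y + z).
Proof.
  intros Hf Hg e He.
  destruct (Hf (e / 2) ltac:(lra)) as (d1 & Hd1 & H1).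
  destruct (Hg (e / 2) ltac:(lra)) as (d2 & Hd2 & H2).
  exists (Rmin d1 d2). split; [now apply Rmin_pos|]. intros h Hh.
  pose proof (Rmin_l d1 d2). pose proof (Rmin_r d1 d2).
  specialize (H1 h ltac:(lra)). specialize (H2 h ltac:(lra)).
  replace (f h + g h - (y + z)) with ((f h - y) + (g h - z)) by ring.
  eapply Rle_trans; [apply Rabs_triang|]. lra.
Qed.

Lemma lim0_scal (c : R) (f : R -> R) (y : R) :
  lim0 f y -> lim0 (fun h => c * f h) (c * y).
Proof.
  intros Hf e He. pose proof (Rabs_pos c) as Hc.
  destruct (Hf (e / (Rabs c + 1))) as (d & Hd & H).
  { apply Rdiv_lt_0_compat; lra. }
  exists d. split; [exact Hd|]. intros h Hh. specialize (H h Hh).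
  rewrite <- Rmult_minus_distr_l, Rabs_mult.
  apply Rle_trans with ((Rabs c + 1) * (e / (Rabs c + 1))).
  - apply Rmult_le_compat; try apply Rabs_pos; lra.
  - right. field. lra.
Qed.

Lemma lim0_dilate (s : R) (f : R -> R) (y : R) :
  0 < s -> lim0 f y -> lim0 (fun h => f (s * h)) y.
Proof.
  intros Hs Hf e He. destruct (Hf e He) as (d & Hd & H).
  exists (d / s). split; [now apply Rdiv_lt_0_compat|]. intros h Hh. apply H. split; [nra|].
  destruct Hh as [_ Hh]. apply Rlt_div_r in Hh; [|exact Hs]. lra.
Qed.

(** * Admissible kernels and their examples *)

Definition decays (phi : R -> R) : Prop :=
  exists C, forall x, 0 <= x -> Rabs (phi x) <= C / (1 + x).

(** Everything concerns the half-line [x >= 0]. Right-continuity at [0] is contained in the bound by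
    [C * x], so continuity is stated only for [x > 0]. *)
Definition admissible (phi : R -> R) : Prop :=
  (exists C, forall x, 0 <= x -> Rabs (phi x) <= C / (1 + x) /\ Rabs (phi x - phi 0) <= C * x) /\
  (forall x, 0 < x -> continuity_pt phi x).

Lemma admissible_exp : admissible (fun x => exp (- x)).
Proof.
  split.
  - exists 1. intros x Hx. pose proof (exp_pos (- x)). split.
    + rewrite Rabs_pos_eq by lra. apply le_div_of_mult; [lra|].
      replace 1 with (exp (- x) * exp x) at 2
        by (rewrite <- exp_plus, Rplus_opp_l; apply exp_0).
      apply Rmult_le_compat_l; [lra|]. apply exp_ineq1_le.
    + rewrite Ropp_0, exp_0, Rabs_minus_sym, Rabs_pos_eq.
      * pose proof (exp_ineq1_le (- x)). lra.
      * enough (exp (- x) <= exp 0) by (rewrite exp_0 in *; lra).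
        destruct Hx as [Hx|<-]; [|rewrite Ropp_0; lra]. left. apply exp_increasing. lra.
  - intros x _. apply continuity_exp_opp.
Qed.

Lemma admissible_cauchy : admissible (fun x => / (1 + x * x)).
Proof.
  split.
  - exists 2. intros x Hx.
    assert (0 < / (1 + x * x)) by (apply Rinv_0_lt_compat; nra). split.
    + rewrite Rabs_pos_eq by lra. apply le_div_of_mult; [lra|].
      rewrite Rmult_comm. apply div_le_of_mult; nra.
    + replace (/ (1 + x * x) - / (1 + 0 * 0)) with (- (x * x / (1 + x * x))) by (field; nra).
      rewrite Rabs_Ropp, Rabs_pos_eq by (apply Rdiv_le_0_compat; nra).
      apply div_le_of_mult; [nra|].
      assert (0 <= x * ((x - 1) * (x - 1) + 1 + x * x)) by (apply Rmult_le_pos; nra). nra.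
  - intros x _. apply continuity_pt_of_is_derive with (d := - (2 * x) / ((1 + x * x) * (1 + x * x))).
    auto_derive; [nra|]. field. nra.
Qed.

Lemma admissible_young (k : R) : 1 <= k -> admissible (young k).
Proof.
  intros Hk. split.
  - exists (2 * k). intros x Hx. split; [now apply young_decay|].
    rewrite young_at_0. pose proof (young_minus_1_le k x Hk Hx). nra.
  - intros x Hx. now apply continuity_pt_young.
Qed.

Lemma admissible_riesz (b : R) : 0 < b -> admissible (fun x => pw (1 - x) b).
Proof.
  intros Hb. split.
  - exists (2 + 2 * b). intros x Hx.
    assert (H1 : 0 <= pw (1 - x) b <= 1).
    { split; [apply pw_ge0|]. rewrite <- (pw_base1 b) at 2. apply pw_le; lra. }
    split.
    + rewrite Rabs_pos_eq by apply H1. apply le_div_of_mult; [lra|].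
      destruct (Rle_dec x 1); [nra|]. rewrite pw_nonpos_base by lra. lra.
    + rewrite Rminus_0_r, pw_base1, Rabs_minus_sym, Rabs_pos_eq by lra.
      destruct (Rle_dec x (1 / 2)) as [Hx2|]; [|nra].
      (* [y^b = exp (b ln y) >= 1 + b ln y] and [ln y >= 1 - 1 / y >= -2 x] for [y = 1 - x] *)
      rewrite pw_Rpower by lra. unfold Rpower.
      pose proof (exp_ineq1_le (b * ln (1 - x))) as He.
      assert (Hln : - ln (1 - x) <= 2 * x).
      { rewrite <- ln_Rinv by lra. apply Rle_trans with (/ (1 - x) - 1).
        - assert (Hy : 0 < / (1 - x)) by (apply Rinv_0_lt_compat; lra).
          pose proof (exp_ineq1_le (ln (/ (1 - x)))) as H. rewrite exp_ln in H by exact Hy. lra.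
        - apply Rle_trans with (2 * x * 1); [|lra].
          replace (/ (1 - x) - 1) with (x / (1 - x)) by (field; lra).
          apply div_le_of_mult; nra. }
      nra.
  - intros x _. apply (continuity_pt_comp (fun x => 1 - x) (fun y => pw y b)).
    + apply continuity_pt_of_is_derive with (d := - 1). auto_derive; [trivial|ring].
    + apply continuity_pt_pw. lra.
Qed.

(** Second-order Taylor bound for [(1 + s)^(-k)]. The remainder [y] obeys the recursion
    [y' = r y + (k + 1) r s^2], and [(k + 1)^2 = k^2 + (k + 1) + k] closes the induction. *)
Lemma inv_1_plus_pow_bounds (s : R) (k : nat) : 0 <= s ->
  0 <= (/ (1 + s)) ^ k - 1 + INR k * s <= INR k ^ 2 * s ^ 2.
Proof.
  intros Hs. set (r := / (1 + s)).
  assert (Hr : r * (1 + s) = 1) by (apply Rinv_l; lra).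
  assert (Hr0 : 0 < r) by (apply Rinv_0_lt_compat; lra).
  assert (Hr1 : r <= 1) by nra.
  induction k as [|k [IH1 IH2]]; [simpl; lra|].
  rewrite S_INR. pose proof (pos_INR k) as Hk. set (n := INR k) in *.
  set (y := r ^ k - 1 + n * s) in *.
  replace (r ^ S k - 1 + (n + 1) * s) with (r * y + (n + 1) * (r * (s * s))).
  2:{ unfold y. simpl.
      replace (r * (r ^ k - 1 + n * s) + (n + 1) * (r * (s * s))) with
        (r * r ^ k + (n + 1) * s * (r * (1 + s)) - r * (1 + s)) by ring.
      rewrite Hr. ring. }
  assert (0 <= s * s) by nra. assert (0 <= r * (s * s)) by nra.
  assert (r * (s * s) <= s * s) by nra.
  split; [nra|].
  assert (r * y <= y) by nra.
  assert ((n + 1) * (r * (s * s)) <= (n + 1) * (s * s)) by (apply Rmult_le_compat_l; lra).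
  replace ((n + 1) ^ 2 * s ^ 2) with (n ^ 2 * s ^ 2 + (n + 1) * (s * s) + n * (s * s)) by ring.
  assert (0 <= n * (s * s)) by (apply Rmult_le_pos; lra). lra.
Qed.

(** The right-hand side depends on [v] alone, so the tails are controlled uniformly over any family
    dominated by [v]; this is what justifies exchanging sum and integral later. *)
Lemma Series_minus_partial_le (u v : nat -> R) :
  (forall n, Rabs (u n) <= v n) -> ex_series v ->
  forall N, Rabs (Series u - sum_n u N) <= Series v - sum_n v N.
Proof.
  intros H Ev N. destruct (Series_dominated u v H Ev) as [Eu _].
  rewrite (Series_incr_n u (S N)), (Series_incr_n v (S N)) by (auto; lia).
  rewrite !sum_n_Reals. simpl pred.
  replace (sum_f_R0 u N + Series (fun k => u (S N + k)%nat) - sum_f_R0 u N) with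
    (Series (fun k => u (S N + k)%nat)) by ring.
  replace (sum_f_R0 v N + Series (fun k => v (S N + k)%nat) - sum_f_R0 v N) with
    (Series (fun k => v (S N + k)%nat)) by ring.
  apply Series_dominated; [intros n; apply H|]. now apply ex_series_incr_n.
Qed.

(* A weight with [min (x, 1 / x) = o (weight x)] at both ends, for which the sums of
   [|a n| * weight (lam n * h)] stay bounded. *)
Definition weight (x : R) : R := sqrt x / (1 + sqrt x) ^ 2.

Lemma weight_ge0 (x : R) : 0 <= weight x.
Proof.
  unfold weight. pose proof (sqrt_pos x). apply Rdiv_le_0_compat; [lra|]. nra.
Qed.

Lemma weight_0 : weight 0 = 0.
Proof. unfold weight. rewrite sqrt_0. apply Rmult_0_l. Qed.

Lemma weight_le_1 (x : R) : weight x <= 1.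
Proof. unfold weight. pose proof (sqrt_pos x). apply div_le_of_mult; nra. Qed.

(** With [s = sqrt x], [weight x >= min (s, 1 / s) / 4] because [(1 + s)^2 <= 4 max (1, s^2)], while
    [e <= B min (s^2, 1 / s^2)]. The spare factor [sqrt x] makes [e] negligible against the weight
    near [0], the spare [1 / sqrt x] near infinity. *)
Lemma sqrt_mult_weight_ge (x e B : R) : 0 <= x -> 0 <= e ->
  e <= B * x -> e * x <= B -> e <= 4 * B * sqrt x * weight x /\ e * sqrt x <= 4 * B * weight x.
Proof.
  intros Hx He H1 H2. unfold weight.
  set (s := sqrt x). assert (Hs : 0 <= s) by apply sqrt_pos.
  assert (Es : x = s * s) by (unfold s; symmetry; now apply sqrt_sqrt).
  assert (HB : 0 <= B) by nra.
  rewrite Es in H1, H2. clearbody s. clear Es.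
  replace (4 * B * s * (s / (1 + s) ^ 2)) with (4 * B * s * s / (1 + s) ^ 2) by (field; nra).
  replace (4 * B * (s / (1 + s) ^ 2)) with (4 * B * s / (1 + s) ^ 2) by (field; nra).
  assert (Hpos : 0 < (1 + s) ^ 2) by (apply pow_lt; lra).
  destruct (Rle_dec s 1) as [H|H].
  - assert (e * (1 + s) ^ 2 <= B * (s * s) * 4).
    { apply Rmult_le_compat; [exact He|nra|exact H1|nra]. }
    assert (0 <= B * s) by (now apply Rmult_le_pos).
    split; apply (le_div_of_mult _ _ _ Hpos); [lra|].
    apply Rle_trans with (B * (s * s) * 4 * s); [nra|].
    assert (0 <= B * s * (1 - s * s)) by (apply Rmult_le_pos; nra). lra.
  - assert ((1 + s) ^ 2 <= 4 * (s * s)) by nra.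
    assert (e * (1 + s) ^ 2 <= 4 * B).
    { apply Rle_trans with (e * (4 * (s * s))); [apply Rmult_le_compat_l; nra|nra]. }
    split; apply (le_div_of_mult _ _ _ Hpos).
    + apply Rle_trans with (4 * B); [lra|].
      assert (1 <= s * s) by nra. nra.
    + nra.
Qed.

Lemma weight_ge (x e B : R) : 0 <= x -> 0 <= e ->
  e <= B * x -> e * x <= B -> e <= 4 * B * weight x.
Proof.
  intros Hx He H1 H2.
  destruct (sqrt_mult_weight_ge x e B Hx He H1 H2) as [H3 H4].
  assert (HB : 0 <= B) by nra. pose proof (weight_ge0 x). pose proof (sqrt_pos x).
  destruct (Rle_dec (sqrt x) 1).
  - assert (0 <= 4 * B * weight x) by nra. nra.
  - nra.
Qed.

(** * Absolute sums under the growth hypothesis *)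

Section Means.

Context (lam a : nat -> R) (l : R).
Context (lam_ge0 : forall n, 0 <= lam n).
Context (lam_incr : forall n, lam n < lam (S n)).
Context (M : R).
Context (HM : forall n, sum_n (fun k => lam k * Rabs (a k)) n <= M * (1 + lam n)).

Lemma lam_pos (n : nat) : 0 < lam (S n).
Proof. pose proof (lam_ge0 n). pose proof (lam_incr n). lra. Qed.

Lemma M_ge0 : 0 <= M.
Proof.
  pose proof (HM 0) as H. rewrite sum_O in H. pose proof (lam_ge0 0). pose proof (Rabs_pos (a 0)).
  assert (0 <= lam 0%nat * Rabs (a 0%nat)) by (apply Rmult_le_pos; lra). nra.
Qed.

(* Abel summation: the left-hand side of [HQ] increases by at most [M (lam (n+1) - lam n) h / (s (1 + s)^2)] with
   [s = sqrt (lam (n+1) h)], and these increments telescope against [1 / (1 + s)]. *)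
Lemma weighted_sum_bounded :
  exists K, 0 < K /\ forall h, 0 < h <= 1 -> forall n,
    sum_n (fun k => Rabs (a k) * weight (lam k * h)) n <= K.
Proof.
  pose proof M_ge0 as HM0. pose proof (lam_pos 0) as Hl1.
  (* The three summands pay for the term of index [0], the boundary term at index [1], and the
     telescoping sum. Index [0] is kept apart because [lam 0] may vanish. *)
  set (K := Rabs (a 0%nat) + M * (1 + lam 1%nat) / sqrt (lam 1%nat) + 2 * M).
  assert (Hsl1 : 0 < sqrt (lam 1%nat)) by now apply sqrt_lt_R0.
  assert (HK1 : 0 <= M * (1 + lam 1%nat) / sqrt (lam 1%nat)).
  { apply Rdiv_le_0_compat; [nra|assumption]. }
  assert (HK : 0 <= K).
  { unfold K. pose proof (Rabs_pos (a 0%nat)). lra. }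
  exists (K + 1). split; [lra|]. intros h Hh.
  enough (Hn : forall n, sum_n (fun k => Rabs (a k) * weight (lam k * h)) n <= K).
  { intros n. specialize (Hn n). lra. }
  set (P := sum_n (fun k => Rabs (a k) * weight (lam k * h))).
  set (D := sum_n (fun k => lam k * Rabs (a k))) in *.
  set (s := fun n => sqrt (lam n * h)).
  (* [om n] is [weight (lam n * h) / lam n], decreasing from index [1] on; it is summed by parts
     against the partial sums [D] of the hypothesis. *)
  set (om := fun n => h / (s n * (1 + s n) ^ 2)).
  assert (Hs : forall n, 0 < s (S n)).
  { intros n. apply sqrt_lt_R0. pose proof (lam_pos n). nra. }
  assert (Hss : forall n, s n * s n = lam n * h).
  { intros n. apply sqrt_sqrt. pose proof (lam_ge0 n). nra. }
  assert (Hsi : forall n, s n <= s (S n)).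
  { intros n. apply sqrt_le_1_alt. pose proof (lam_incr n). nra. }
  assert (Hom : forall n, 0 < om (S n)).
  { intros n. specialize (Hs n). apply Rdiv_lt_0_compat; [lra|].
    apply Rmult_lt_0_compat; [lra|]. nra. }
  assert (Hw : forall n, weight (lam (S n) * h) = lam (S n) * om (S n)).
  { intros n. unfold weight, om. fold (s (S n)). specialize (Hs n).
    replace (lam (S n) * (h / (s (S n) * (1 + s (S n)) ^ 2))) with
      (lam (S n) * h / (s (S n) * (1 + s (S n)) ^ 2)) by (field; nra).
    rewrite <- Hss. field. nra. }
  assert (Homd : forall n, om (S (S n)) <= om (S n)).
  { intros n. pose proof (Hs n) as H1. pose proof (Hsi (S n)) as H2.
    unfold om, Rdiv. apply Rmult_le_compat_l; [lra|].
    apply Rinv_le_contravar; [nra|].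
    apply Rmult_le_compat; nra. }
  assert (Hstep : forall n, (lam (S (S n)) - lam (S n)) * om (S (S n)) <=
                      2 * (/ (1 + s (S n)) - / (1 + s (S (S n))))).
  { intros n. pose proof (Hs n) as H1. pose proof (Hsi (S n)) as H2.
    unfold om. set (r := s (S n)) in *. set (t := s (S (S n))) in *.
    replace ((lam (S (S n)) - lam (S n)) * (h / (t * (1 + t) ^ 2))) with
      ((t * t - r * r) / (t * (1 + t) ^ 2)).
    2:{ unfold t, r. rewrite !Hss. fold r t. field. nra. }
    replace (2 * (/ (1 + r) - / (1 + t))) with (2 * (t - r) / ((1 + r) * (1 + t)))
      by (field; lra).
    apply le_div_of_mult; [nra|].
    replace ((t * t - r * r) / (t * (1 + t) ^ 2) * ((1 + r) * (1 + t))) with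
      ((t - r) * ((t + r) * (1 + r)) / (t * (1 + t))) by (field; nra).
    apply div_le_of_mult; [nra|].
    replace (2 * (t - r) * (t * (1 + t))) with ((t - r) * (2 * t * (1 + t))) by ring.
    apply Rmult_le_compat_l; [lra|]. nra. }
  assert (HPS : forall n, P (S n) = P n + lam (S n) * Rabs (a (S n)) * om (S n)).
  { intros n. unfold P. rewrite sum_Sn. unfold plus; simpl. rewrite Hw. ring. }
  assert (HDS : forall n, D (S n) = D n + lam (S n) * Rabs (a (S n))).
  { intros n. unfold D. rewrite sum_Sn. reflexivity. }
  assert (HQ : forall n, P (S n) + (M * (1 + lam (S n)) - D (S n)) * om (S n) <=
     P 0%nat + M * (1 + lam 1%nat) * om 1%nat + 2 * M * (/ (1 + s 1%nat) - / (1 + s (S n)))).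
  { induction n as [|n IH].
    - rewrite HPS, HDS.
      assert (0 <= D 0%nat).
      { unfold D. rewrite sum_O. apply Rmult_le_pos; [apply lam_ge0|apply Rabs_pos]. }
      specialize (Hom 0%nat). nra.
    - rewrite HPS.
      assert (E1 : (M * (1 + lam (S n)) - D (S n)) * om (S (S n)) <=
                   (M * (1 + lam (S n)) - D (S n)) * om (S n)).
      { apply Rmult_le_compat_l; [|apply Homd]. specialize (HM (S n)). lra. }
      pose proof (Rmult_le_compat_l M _ _ HM0 (Hstep n)) as E2.
      rewrite HDS. nra. }
  (* The restriction [h <= 1] enters here: [om 1 <= sqrt (h / lam 1)]. *)
  assert (Hom1 : om 1%nat <= / sqrt (lam 1%nat)).
  { unfold om. pose proof (Hs 0%nat) as H1.
    apply Rle_trans with (h / s 1%nat).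
    - apply Rmult_le_compat_l; [lra|]. apply Rinv_le_contravar; [lra|].
      rewrite <- (Rmult_1_r (s 1%nat)) at 1. apply Rmult_le_compat_l; [lra|]. nra.
    - unfold s. rewrite sqrt_mult by lra.
      assert (Hh0 : 0 < sqrt h) by (apply sqrt_lt_R0; lra).
      assert (Hh1 : sqrt h <= 1) by (rewrite <- sqrt_1; apply sqrt_le_1_alt; lra).
      replace (h / (sqrt (lam 1%nat) * sqrt h)) with (sqrt h / sqrt (lam 1%nat)).
      + unfold Rdiv. rewrite <- (Rmult_1_l (/ sqrt (lam 1%nat))) at 2.
        apply Rmult_le_compat_r; [|exact Hh1]. left. now apply Rinv_0_lt_compat.
      + rewrite <- (sqrt_sqrt h) at 2 by lra. field. lra. }
  assert (HP0 : P 0%nat <= Rabs (a 0%nat)).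
  { unfold P. rewrite sum_O. rewrite <- Rmult_1_r.
    apply Rmult_le_compat_l; [apply Rabs_pos|apply weight_le_1]. }
  intros [|n]; fold P.
  - unfold K. lra.
  - specialize (HQ n). unfold K, Rdiv.
    pose proof (Rmult_le_compat_l (M * (1 + lam 1%nat)) _ _ ltac:(nra) Hom1) as E1.
    assert (E2 : 0 <= (M * (1 + lam (S n)) - D (S n)) * om (S n)).
    { apply Rmult_le_pos; [|left; apply Hom]. specialize (HM (S n)). lra. }
    assert (E3 : / (1 + s 1%nat) <= 1).
    { rewrite <- Rinv_1 at 2. apply Rinv_le_contravar; [lra|]. specialize (Hs 0%nat). lra. }
    assert (E4 : 0 < / (1 + s (S n))).
    { apply Rinv_0_lt_compat. specialize (Hs n). lra. }
    assert (E5 : 2 * M * (/ (1 + s 1%nat) - / (1 + s (S n))) <= 2 * M * 1).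
    { apply Rmult_le_compat_l; lra. }
    lra.
Qed.

(** For [x >= lam 1] the function [1 / (1 + x h)] is at most a constant times [weight x], so the
    weighted bound at parameter [1] suffices. The constant depends on [h]: the convergence is not
    claimed to be uniform. The term of index [0] is dropped since the weight vanishes if
    [lam 0 = 0]. *)
Lemma ex_series_over_1_plus (h : R) : 0 < h ->
  ex_series (fun n => Rabs (a n) / (1 + lam n * h)).
Proof.
  intros Hh. destruct weighted_sum_bounded as (K & HK & HKs).
  set (s1 := sqrt (lam 1%nat)).
  assert (Hs1 : 0 < s1) by (apply sqrt_lt_R0, lam_pos).
  apply (ex_series_incr_1 (fun n => Rabs (a n) / (1 + lam n * h))).
  apply (ex_series_le (K := R_AbsRing) (V := R_CompleteNormedModule) _
    (fun n => scal (2 * (1 + / h) / s1) (Rabs (a (S n)) * weight (lam (S n) * 1)))).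
  - intros n. unfold norm, scal; simpl. unfold abs, mult; simpl.
    set (x := lam (S n)). assert (Hx : 0 < x) by apply lam_pos.
    assert (Hih : 0 < / h) by now apply Rinv_0_lt_compat.
    assert (Hhh : / h * h = 1) by (apply Rinv_l; lra).
    rewrite Rabs_pos_eq by (apply Rdiv_le_0_compat; [apply Rabs_pos|nra]).
    replace (2 * (1 + / h) / s1 * (Rabs (a (S n)) * weight (x * 1))) with
      (Rabs (a (S n)) * (2 * (1 + / h) / s1 * weight (x * 1))) by ring.
    unfold Rdiv at 1. apply Rmult_le_compat_l; [apply Rabs_pos|].
    rewrite Rmult_1_r. unfold weight.
    assert (Hsx : s1 <= sqrt x).
    { apply sqrt_le_1_alt. unfold x. clear -lam_incr. induction n as [|n IH]; [lra|].
      specialize (lam_incr (S n)). lra. }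
    set (s := sqrt x) in *. assert (Es : x = s * s) by (unfold s; symmetry; apply sqrt_sqrt; lra).
    apply Rle_trans with ((1 + / h) / (1 + x)).
    + apply le_div_of_mult; [lra|]. rewrite Rmult_comm. apply div_le_of_mult; [nra|]. nra.
    + replace (2 * (1 + / h) / s1 * (s / (1 + s) ^ 2)) with
        ((1 + / h) * (2 * s / (s1 * (1 + s) ^ 2))) by (field; nra).
      unfold Rdiv at 1. apply Rmult_le_compat_l; [lra|].
      apply le_div_of_mult; [nra|]. rewrite Rmult_comm. apply div_le_of_mult; [lra|].
      rewrite Es.
      assert (s1 * (1 + s) ^ 2 <= s * (1 + s) ^ 2) by (apply Rmult_le_compat_r; nra).
      assert (s * (1 + s) ^ 2 <= 2 * s * (1 + s * s)).
      { assert (0 <= s * ((1 - s) * (1 - s))) by (apply Rmult_le_pos; [lra|apply Rle_0_sqr]). lra. }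
      lra.
  - apply (ex_series_scal (K := R_AbsRing) (V := R_NormedModule)).
    apply (ex_series_incr_1 (fun n => Rabs (a n) * weight (lam n * 1))).
    apply (ex_series_of_bounded _ K).
    + intros n. apply Rmult_le_pos; [apply Rabs_pos|apply weight_ge0].
    + apply HKs. lra.
Qed.

(** * Means and closure properties of regular kernels *)

Definition mean (phi : R -> R) (h : R) : R := Series (fun n => a n * phi (lam n * h)).

Lemma mean_terms_dominated (phi : R -> R) (C h : R) : 0 < h ->
  (forall x, 0 <= x -> Rabs (phi x) <= C / (1 + x)) ->
  forall n, Rabs (a n * phi (lam n * h)) <= C * (Rabs (a n) / (1 + lam n * h)).
Proof.
  intros Hh HC n. rewrite Rabs_mult.
  replace (C * (Rabs (a n) / (1 + lam n * h))) with (Rabs (a n) * (C / (1 + lam n * h)))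
    by (unfold Rdiv; ring).
  apply Rmult_le_compat_l; [apply Rabs_pos|]. apply HC.
  specialize (lam_ge0 n). nra.
Qed.

Lemma ex_series_mean (phi : R -> R) (h : R) :
  decays phi -> 0 < h -> ex_series (fun n => a n * phi (lam n * h)).
Proof.
  intros [C HC] Hh.
  apply (Series_dominated _ (fun n => C * (Rabs (a n) / (1 + lam n * h)))).
  - now apply mean_terms_dominated.
  - apply (ex_series_scal (K := R_AbsRing) (V := R_NormedModule) C
      (fun n => Rabs (a n) / (1 + lam n * h))). now apply ex_series_over_1_plus.
Qed.

(** The limit [phi 0 * l] is linear in [phi], so regular kernels form a vector space without any
    normalisation at [0]. *)
Definition mean_regular (phi : R -> R) : Prop :=
  decays phi /\ lim0 (mean phi) (phi 0 * l).

Lemma mean_regular_ext (phi psi : R -> R) :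
  (forall x, 0 <= x -> phi x = psi x) -> mean_regular phi -> mean_regular psi.
Proof.
  intros E [[C HC] L]. split.
  - exists C. intros x Hx. rewrite <- E by exact Hx. now apply HC.
  - rewrite <- E by lra. eapply lim0_ext; [|exact L]. intros h Hh. apply Series_ext.
    intros n. rewrite E; [reflexivity|]. specialize (lam_ge0 n). nra.
Qed.

Lemma mean_regular_plus (phi psi : R -> R) :
  mean_regular phi -> mean_regular psi -> mean_regular (fun x => phi x + psi x).
Proof.
  intros [D1 L1] [D2 L2]. split.
  - destruct D1 as [C1 H1], D2 as [C2 H2]. exists (C1 + C2). intros x Hx.
    eapply Rle_trans; [apply Rabs_triang|]. rewrite Rdiv_plus_distr.
    apply Rplus_le_compat; auto.
  - rewrite Rmult_plus_distr_r. eapply lim0_ext; [|apply (lim0_plus _ _ _ _ L1 L2)].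
    intros h Hh. unfold mean. rewrite <- Series_plus by now apply ex_series_mean.
    apply Series_ext. intros n. ring.
Qed.

Lemma mean_regular_scal (c : R) (phi : R -> R) :
  mean_regular phi -> mean_regular (fun x => c * phi x).
Proof.
  intros [D1 L1]. split.
  - destruct D1 as [C1 H1]. exists (Rabs c * C1). intros x Hx.
    rewrite Rabs_mult. unfold Rdiv. rewrite Rmult_assoc.
    apply Rmult_le_compat_l; [apply Rabs_pos|]. now apply H1.
  - rewrite Rmult_assoc. eapply lim0_ext; [|apply (lim0_scal c _ _ L1)].
    intros h Hh. unfold mean. rewrite <- Series_scal_l.
    apply Series_ext. intros n. ring.
Qed.

Lemma mean_regular_dilate (s : R) (phi : R -> R) :
  0 < s -> mean_regular phi -> mean_regular (fun x => phi (s * x)).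
Proof.
  intros Hs [D1 L1]. split.
  - destruct D1 as [C1 H1]. exists (C1 * (1 + / s)). intros x Hx.
    eapply Rle_trans; [apply H1; nra|].
    assert (HC : 0 <= C1).
    { pose proof (H1 0 (Rle_refl 0)) as H. pose proof (Rabs_pos (phi 0)).
      rewrite Rplus_0_r, Rdiv_1_r in H. lra. }
    assert (Hi : 0 < / s) by now apply Rinv_0_lt_compat.
    assert (Hss : / s * s = 1) by (apply Rinv_l; lra).
    unfold Rdiv. rewrite Rmult_assoc. apply Rmult_le_compat_l; [exact HC|].
    apply le_div_of_mult; [lra|]. rewrite Rmult_comm. apply div_le_of_mult; [nra|]. nra.
  - rewrite Rmult_0_r. eapply lim0_ext; [|apply (lim0_dilate s _ _ Hs L1)].
    intros h Hh. unfold mean. apply Series_ext. intros n. do 2 f_equal. ring.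
Qed.

(** The means of [phi] and [psi] differ by at most [eps * K] for all [h <= 1], with [K] from
    [weighted_sum_bounded]. As [weight 0 = 0], the approximant takes the same value at [0], hence
    its means have the same limit. *)
Lemma mean_regular_closed (phi : R -> R) :
  decays phi ->
  (forall eps, 0 < eps -> exists psi, mean_regular psi /\
     forall x, 0 <= x -> Rabs (phi x - psi x) <= eps * weight x) ->
  mean_regular phi.
Proof.
  intros Dphi Happ. split; [exact Dphi|]. intros e He.
  destruct weighted_sum_bounded as (K & HK & HKs).
  destruct (Happ (e / (2 * K))) as (psi & [Dpsi L] & Hpsi).
  { apply Rdiv_lt_0_compat; lra. }
  assert (E0 : phi 0 = psi 0).
  { specialize (Hpsi 0 (Rle_refl 0)). rewrite weight_0, Rmult_0_r in Hpsi.
    pose proof (Rabs_pos (phi 0 - psi 0)).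
    assert (E : Rabs (phi 0 - psi 0) = 0) by lra. apply Rabs_eq_0 in E. lra. }
  destruct (L (e / 2) ltac:(lra)) as (d & Hd & HL).
  exists (Rmin d 1). split; [apply Rmin_pos; lra|]. intros h Hh.
  pose proof (Rmin_l d 1). pose proof (Rmin_r d 1).
  specialize (HL h ltac:(lra)). rewrite E0.
  assert (Hdiff : Rabs (mean phi h - mean psi h) <= e / 2).
  { unfold mean. rewrite <- Series_minus by (apply ex_series_mean; auto; lra).
    destruct (ex_series_of_bounded (fun n => Rabs (a n) * weight (lam n * h)) K) as [Ew Bw].
    - intros n. apply Rmult_le_pos; [apply Rabs_pos|apply weight_ge0].
    - apply HKs. lra.
    - eapply Rle_trans.
      + apply (Series_dominated _ (fun n => e / (2 * K) * (Rabs (a n) * weight (lam n * h)))).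
        * intros n. rewrite <- Rmult_minus_distr_l, Rabs_mult.
          replace (e / (2 * K) * (Rabs (a n) * weight (lam n * h))) with
            (Rabs (a n) * (e / (2 * K) * weight (lam n * h))) by ring.
          apply Rmult_le_compat_l; [apply Rabs_pos|]. apply Hpsi.
          specialize (lam_ge0 n). nra.
        * apply (ex_series_scal (K := R_AbsRing) (V := R_NormedModule) (e / (2 * K))
            (fun n => Rabs (a n) * weight (lam n * h))). exact Ew.
      + rewrite Series_scal_l. apply Rle_trans with (e / (2 * K) * K).
        * apply Rmult_le_compat_l; [|exact Bw]. apply Rdiv_le_0_compat; lra.
        * right. field. lra. }
  replace (mean phi h - psi 0 * l) with
    ((mean phi h - mean psi h) + (mean psi h - psi 0 * l)) by ring.
  eapply Rle_trans; [apply Rabs_triang|]. lra.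
Qed.

(** Each step of the recursion for [binomial_mean] contributes a factor [u] or [1 - u], so the
    exponents [j] and [k] are left free. One factor [u] is always kept: it provides the decay that a
    constant lacks. *)
Lemma mean_regular_bernstein (u : R -> R) :
  (forall k, mean_regular (fun x => u x ^ S k)) ->
  forall n j k g, mean_regular (fun x => u x ^ S j * (1 - u x) ^ k * binomial_mean n (u x) g).
Proof.
  intros Hu.
  assert (H0 : forall k j, mean_regular (fun x => u x ^ S j * (1 - u x) ^ k)).
  { induction k as [|k IH]; intros j.
    - apply (mean_regular_ext (fun x => u x ^ S j)); [intros; simpl; ring|apply Hu].
    - apply (mean_regular_ext
        (fun x => u x ^ S j * (1 - u x) ^ k + (-1) * (u x ^ S (S j) * (1 - u x) ^ k))).
      + intros; simpl; ring.
      + apply mean_regular_plus; [apply IH|]. apply mean_regular_scal, IH. }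
  induction n as [|n IH]; intros j k g.
  - apply (mean_regular_ext (fun x => g O * (u x ^ S j * (1 - u x) ^ k))).
    + intros; simpl; ring.
    + apply mean_regular_scal, H0.
  - apply (mean_regular_ext (fun x =>
      u x ^ S (S j) * (1 - u x) ^ k * binomial_mean n (u x) (fun i => g (S i)) +
      u x ^ S j * (1 - u x) ^ S k * binomial_mean n (u x) g)).
    + intros; simpl; ring.
    + apply mean_regular_plus; apply IH.
Qed.

(* [phi - phi 0 * u] is cut off near [0] and infinity at the cost of [eps * weight]; divided by
   [u (1 - u)] it is then a continuous function of [u], to be approximated by polynomials in [u]. *)
Lemma mean_regular_of_powers (u inv : R -> R) :
  u 0 = 1 ->
  (forall x, 0 < x -> 0 < u x < 1) ->
  (forall x y, 0 <= x <= y -> u y <= u x) ->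
  (forall t, 0 < t < 1 -> 0 < inv t /\ u (inv t) = t /\ continuity_pt inv t) ->
  (forall x, 0 < x -> inv (u x) = x) ->
  admissible u ->
  (forall k, mean_regular (fun x => u x ^ S k)) ->
  forall phi, admissible phi -> mean_regular phi.
Proof.
  intros u0 u01 u_dec inv_u u_inv [[Cu HCu] _] u_pow phi [[Cp HCp] phi_cont].
  apply mean_regular_closed.
  { exists Cp. intros x Hx. now apply HCp. }
  intros eps Heps.
  set (B := Cp + Rabs (phi 0) * Cu).
  set (g := fun x => phi x - phi 0 * u x).
  assert (HCu0 : 0 <= Cu).
  { destruct (HCu 1 ltac:(lra)) as [_ H]. pose proof (Rabs_pos (u 1 - u 0)). lra. }
  assert (HCp0 : 0 <= Cp).
  { destruct (HCp 1 ltac:(lra)) as [_ H]. pose proof (Rabs_pos (phi 1 - phi 0)). lra. }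
  assert (HB : 0 <= B).
  { unfold B. pose proof (Rabs_pos (phi 0)). nra. }
  assert (Hg1 : forall x, 0 <= x -> Rabs (g x) <= B * x).
  { intros x Hx. unfold g, B.
    replace (phi x - phi 0 * u x) with ((phi x - phi 0) - phi 0 * (u x - u 0)) by (rewrite u0; ring).
    eapply Rle_trans; [apply Rabs_triang|]. rewrite Rabs_Ropp, Rabs_mult, Rmult_plus_distr_r.
    apply Rplus_le_compat; [now apply HCp|]. rewrite Rmult_assoc.
    apply Rmult_le_compat_l; [apply Rabs_pos|]. now apply HCu. }
  assert (Hg2 : forall x, 0 <= x -> Rabs (g x) * x <= B).
  { intros x Hx.
    assert (Rabs (g x) <= B / (1 + x)).
    { unfold g, B. eapply Rle_trans; [apply Rabs_triang|].
      rewrite Rabs_Ropp, Rabs_mult, Rdiv_plus_distr.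
      apply Rplus_le_compat; [now apply HCp|]. unfold Rdiv. rewrite Rmult_assoc.
      apply Rmult_le_compat_l; [apply Rabs_pos|]. now apply HCu. }
    apply Rle_trans with (B / (1 + x) * x); [now apply Rmult_le_compat_r|].
    replace (B / (1 + x) * x) with (B * x / (1 + x)) by (field; lra).
    apply div_le_of_mult; nra. }
  set (e1 := eps / 2). assert (He1 : 0 < e1) by (unfold e1; lra).
  assert (Hsmall : exists d, 0 < d /\ forall x, 0 <= x <= d -> Rabs (g x) <= e1 * weight x).
  (* Chosen so that [4 B sqrt x <= e1]; the [+ 1] covers [B = 0]. *)
  { exists ((e1 / (4 * B + 1)) * (e1 / (4 * B + 1))).
    assert (Hq : 0 < e1 / (4 * B + 1)) by (apply Rdiv_lt_0_compat; lra).
    split; [nra|]. intros x Hx.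
    destruct (sqrt_mult_weight_ge x (Rabs (g x)) B) as [H _]; auto; try apply Rabs_pos; try lra.
    { apply Hg1; lra. } { apply Hg2; lra. }
    eapply Rle_trans; [exact H|]. apply Rmult_le_compat_r; [apply weight_ge0|].
    assert (Hs : sqrt x <= e1 / (4 * B + 1)).
    { rewrite <- (sqrt_square (e1 / (4 * B + 1))) by lra. apply sqrt_le_1_alt. lra. }
    apply Rle_trans with ((4 * B + 1) * (e1 / (4 * B + 1))).
    - apply Rmult_le_compat; [lra|apply sqrt_pos|lra|exact Hs].
    - right. field. lra. }
  assert (Hlarge : exists A, 0 < A /\ forall x, A <= x -> Rabs (g x) <= e1 * weight x).
  { set (r := (4 * B + 1) / e1). assert (Hr : 0 < r) by (apply Rdiv_lt_0_compat; lra).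
    exists (r * r). split; [nra|]. intros x Hx.
    assert (Hx0 : 0 < x) by nra.
    destruct (sqrt_mult_weight_ge x (Rabs (g x)) B) as [_ H]; auto; try apply Rabs_pos; try lra.
    { apply Hg1; lra. } { apply Hg2; lra. }
    assert (Hs : r <= sqrt x).
    { rewrite <- (sqrt_square r) by lra. apply sqrt_le_1_alt. lra. }
    apply Rmult_le_reg_r with (sqrt x); [lra|]. eapply Rle_trans; [exact H|].
    pose proof (weight_ge0 x).
    replace (e1 * weight x * sqrt x) with (e1 * sqrt x * weight x) by ring.
    apply Rmult_le_compat_r; [assumption|].
    apply Rle_trans with (e1 * r).
    - unfold r. replace (e1 * ((4 * B + 1) / e1)) with (4 * B + 1) by (field; lra). lra.
    - apply Rmult_le_compat_l; lra. }
  destruct Hsmall as (d & Hd & Hsmall). destruct Hlarge as (A & HA & Hlarge).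
  (* Soft thresholding: it moves [y] by at most [b], annihilates it when [|y| <= b], and is
     continuous in both arguments. *)
  set (cut := fun y b : R => y - Rmax (- b) (Rmin b y)).
  assert (Hcut0 : forall y b, Rabs y <= b -> cut y b = 0).
  { intros y b H. apply Rabs_le_between in H. unfold cut.
    rewrite Rmin_right, Rmax_right by lra. ring. }
  assert (Hcut : forall y b, 0 <= b -> Rabs (y - cut y b) <= b).
  { intros y b Hb. unfold cut.
    replace (y - (y - Rmax (- b) (Rmin b y))) with (Rmax (- b) (Rmin b y)) by ring.
    apply Rabs_le. split; [apply Rmax_l|]. apply Rmax_lub; [lra|apply Rmin_l]. }
  set (q0 := fun t => cut (g (inv t)) (e1 * weight (inv t)) / (t * (1 - t))).
  (* The extension by [0] is continuous: the thresholding makes [q0] vanish already for [t < u A]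
     and for [t > u d], that is, near both endpoints. *)
  set (q := fun t => if Rlt_dec 0 t then if Rlt_dec t 1 then q0 t else 0 else 0).
  assert (Hq_in : forall t, 0 < t < 1 -> q t = q0 t).
  { intros t Ht. unfold q. destruct (Rlt_dec 0 t); [|lra]. destruct (Rlt_dec t 1); [|lra].
    reflexivity. }
  assert (Hq_zero : forall t, (t < u A \/ u d < t) -> q t = 0).
  { intros t Ht. unfold q. destruct (Rlt_dec 0 t) as [H1|]; [|reflexivity].
    destruct (Rlt_dec t 1) as [H2|]; [|reflexivity].
    destruct (inv_u t (conj H1 H2)) as (Hi & Ei & _).
    unfold q0. rewrite Hcut0; [apply Rmult_0_l|].
    destruct Ht as [Ht|Ht].
    - apply Hlarge. destruct (Rle_dec A (inv t)) as [|Hn]; [assumption|].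
      specialize (u_dec (inv t) A ltac:(lra)). lra.
    - apply Hsmall. split; [lra|]. destruct (Rle_dec (inv t) d) as [|Hn]; [assumption|].
      specialize (u_dec d (inv t) ltac:(lra)). lra. }
  assert (Hloc0 : forall (a0 b0 t : R), a0 < t < b0 -> (forall s, a0 < s < b0 -> q s = 0) ->
            continuity_pt q t).
  { intros a0 b0 t Ht H. apply (continuity_pt_ext_loc (fun _ => 0)).
    - assert (Hr : 0 < Rmin (t - a0) (b0 - t)) by (apply Rmin_pos; lra).
      exists (mkposreal _ Hr). intros s Hs. symmetry. apply H.
      change (Rabs (s - t) < Rmin (t - a0) (b0 - t)) in Hs.
      pose proof (Rmin_l (t - a0) (b0 - t)). pose proof (Rmin_r (t - a0) (b0 - t)).
      apply Rabs_lt_between in Hs. lra.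
    - apply continuity_pt_const. intros ? ?; reflexivity. }
  assert (Hq_cont : forall t, 0 <= t <= 1 -> continuity_pt q t).
  { intros t Ht. pose proof (u01 A HA) as HuA. pose proof (u01 d Hd) as Hud.
    destruct (Req_dec t 0) as [->|Ht0].
    { apply (Hloc0 (-1) (u A)); [lra|]. intros s Hs. apply Hq_zero. lra. }
    destruct (Req_dec t 1) as [->|Ht1].
    { apply (Hloc0 (u d) 2); [lra|]. intros s Hs. apply Hq_zero. lra. }
    assert (Ht' : 0 < t < 1) by lra.
    destruct (inv_u t Ht') as (Hi & Ei & Ci).
    apply (continuity_pt_ext_loc q0).
    - assert (Hr : 0 < Rmin t (1 - t)) by (apply Rmin_pos; lra).
      exists (mkposreal _ Hr). intros s Hs. symmetry. apply Hq_in.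
      change (Rabs (s - t) < Rmin t (1 - t)) in Hs.
      pose proof (Rmin_l t (1 - t)). pose proof (Rmin_r t (1 - t)).
      apply Rabs_lt_between in Hs. lra.
    - assert (Cg : continuity_pt (fun s => phi (inv s) - phi 0 * s) t).
      { apply continuity_pt_minus.
        - apply (continuity_pt_comp inv phi); [exact Ci|]. now apply phi_cont.
        - apply (continuity_pt_scal (fun s => s)). apply derivable_continuous_pt, derivable_pt_id. }
      assert (Cgi : continuity_pt (fun s => g (inv s)) t).
      { apply (continuity_pt_ext_loc (fun s => phi (inv s) - phi 0 * s)); [|exact Cg].
        assert (Hr : 0 < Rmin t (1 - t)) by (apply Rmin_pos; lra).
        exists (mkposreal _ Hr). intros s Hs.
        change (Rabs (s - t) < Rmin t (1 - t)) in Hs.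
        pose proof (Rmin_l t (1 - t)). pose proof (Rmin_r t (1 - t)).
        apply Rabs_lt_between in Hs. unfold g.
        destruct (inv_u s ltac:(lra)) as (_ & -> & _). reflexivity. }
      assert (Cw : continuity_pt (fun s => e1 * weight (inv s)) t).
      { apply (continuity_pt_scal (fun s => weight (inv s))).
        apply (continuity_pt_comp inv weight); [exact Ci|].
        unfold weight. pose proof (sqrt_pos (inv t)).
        assert (Cs : continuity_pt sqrt (inv t)) by (apply continuity_pt_sqrt; lra).
        assert (C1 : continuity_pt (fun x => 1 + sqrt x) (inv t)).
        { apply (continuity_pt_plus (fun _ => 1) sqrt); [|exact Cs].
          apply continuity_pt_const. intros ? ?; reflexivity. }
        apply (continuity_pt_ext (fun x => sqrt x / ((1 + sqrt x) * (1 + sqrt x)))).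
        { intros x. simpl. now rewrite Rmult_1_r. }
        apply (continuity_pt_div sqrt (fun x => (1 + sqrt x) * (1 + sqrt x))).
        - exact Cs.
        - apply (continuity_pt_mult (fun x => 1 + sqrt x) (fun x => 1 + sqrt x)); exact C1.
        - nra. }
      unfold q0. apply (continuity_pt_div (fun s => cut (g (inv s)) (e1 * weight (inv s)))
        (fun s => s * (1 - s))).
      + unfold cut.
        set (f1 := fun s => g (inv s)) in *. set (f2 := fun s => e1 * weight (inv s)) in *.
        apply (continuity_pt_minus f1 (fun s => Rmax (- f2 s) (Rmin (f2 s) (f1 s)))); [exact Cgi|].
        (* Maximum and minimum are rewritten with absolute values, a form that [reg] handles. *)
        apply (continuity_pt_ext (fun s =>
          ((- f2 s + (f2 s + f1 s - Rabs (f2 s - f1 s)) / 2) +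
           Rabs (- f2 s - (f2 s + f1 s - Rabs (f2 s - f1 s)) / 2)) / 2)).
        { intros s. unfold Rmin, Rmax, Rabs.
          destruct (Rcase_abs (f2 s - f1 s)); destruct (Rle_dec (f2 s) (f1 s)); try lra;
          destruct (Rcase_abs _); destruct (Rle_dec _ _); lra. }
        reg.
      + apply continuity_pt_of_is_derive with (d := 1 - 2 * t).
        auto_derive; [trivial|ring].
      + nra. }
  (* Multiplying back by [u (1 - u)] turns a uniform error in [q] into an error relative to
     [weight]; [e2] is chosen so that [4 Cu e2 <= eps / 2]. *)
  assert (Huw : forall x, 0 <= x -> u x * (1 - u x) <= 4 * Cu * weight x).
  { intros x Hx. destruct (HCu x Hx) as [H1 H2].
    assert (Hu : 0 <= u x <= 1).
    { destruct Hx as [Hx|<-]; [specialize (u01 x Hx)|]; lra. }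
    rewrite Rabs_pos_eq in H1 by lra. rewrite u0, Rabs_minus_sym, Rabs_pos_eq in H2 by lra.
    apply weight_ge; [exact Hx|nra|nra|].
    apply Rle_trans with (Cu / (1 + x) * x); [nra|].
    replace (Cu / (1 + x) * x) with (Cu * x / (1 + x)) by (field; lra).
    apply div_le_of_mult; nra. }
  set (e2 := eps / (2 * (4 * Cu + 1))).
  assert (He2 : 0 < e2) by (apply Rdiv_lt_0_compat; lra).
  destruct (weierstrass q e2 Hq_cont He2) as (n & gn & Hn).
  exists (fun x => phi 0 * u x + u x ^ 1 * (1 - u x) ^ 1 * binomial_mean n (u x) gn).
  split.
  { apply mean_regular_plus.
    - apply mean_regular_scal. apply (mean_regular_ext (fun x => u x ^ 1)).
      + intros; simpl; ring.
      + apply u_pow.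
    - now apply mean_regular_bernstein. }
  intros x [Hx|<-].
  - pose proof (u01 x Hx) as Hux. set (t := u x) in *.
    assert (Eq : q t * (t * (1 - t)) = cut (g x) (e1 * weight x)).
    { rewrite Hq_in by exact Hux. unfold q0, t. rewrite u_inv by exact Hx. fold t.
      field. lra. }
    replace (phi x - (phi 0 * t + t ^ 1 * (1 - t) ^ 1 * binomial_mean n t gn)) with
      ((g x - cut (g x) (e1 * weight x)) + t * (1 - t) * (q t - binomial_mean n t gn)).
    2:{ rewrite <- Eq. unfold g. fold t. ring. }
    eapply Rle_trans; [apply Rabs_triang|].
    pose proof (weight_ge0 x) as Hw.
    assert (H1 : Rabs (g x - cut (g x) (e1 * weight x)) <= e1 * weight x).
    { apply Hcut. nra. }
    assert (H2 : Rabs (t * (1 - t) * (q t - binomial_mean n t gn)) <= e1 * weight x).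
    { rewrite Rabs_mult, Rabs_pos_eq by nra.
      apply Rle_trans with (4 * Cu * weight x * e2).
      - apply Rmult_le_compat; [nra|apply Rabs_pos|apply Huw; lra|apply Hn; lra].
      - apply Rle_trans with ((4 * Cu + 1) * e2 * weight x); [nra|].
        right. unfold e2, e1. field. lra. }
    replace (eps * weight x) with (e1 * weight x + e1 * weight x) by (unfold e1; lra). lra.
  - rewrite u0, weight_0, Rmult_0_r.
    replace (phi 0 - (phi 0 * 1 + 1 ^ 1 * (1 - 1) ^ 1 * binomial_mean n 1 gn)) with 0 by ring.
    rewrite Rabs_R0. lra.
Qed.

(** * The two generators *)

Lemma mean_regular_of_exp :
  mean_regular (fun x => exp (- x)) -> forall phi, admissible phi -> mean_regular phi.
Proof.
  intros Hexp. apply (mean_regular_of_powers (fun x => exp (- x)) (fun t => - ln t)).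
  - now rewrite Ropp_0, exp_0.
  - intros x Hx. split; [apply exp_pos|]. rewrite <- exp_0. apply exp_increasing. lra.
  - intros x y Hxy. destruct (Req_dec x y) as [->|H]; [lra|].
    left. apply exp_increasing. lra.
  - intros t Ht. repeat split.
    + enough (ln t < 0) by lra. rewrite <- ln_1. apply ln_increasing; lra.
    + rewrite Ropp_involutive. apply exp_ln. lra.
    + apply continuity_pt_of_is_derive with (d := - / t). auto_derive; [lra|]. field. lra.
  - intros x Hx. rewrite ln_exp. ring.
  - apply admissible_exp.
  (* The powers of [exp (- x)] are its own dilations by [k + 1]. *)
  - intros k. apply (mean_regular_ext (fun x => exp (- (INR (S k) * x)))).
    + intros x _. induction (S k) as [|j IH]; [now rewrite Rmult_0_l, Ropp_0, exp_0|].
      simpl pow. rewrite <- IH, <- exp_plus, S_INR. f_equal. ring.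
    + apply (mean_regular_dilate (INR (S k)) (fun x => exp (- x))); [|exact Hexp].
      apply lt_0_INR. lia.
Qed.

(* [v^(k+1)] is obtained by differentiating [v (sqrt b x) ^ k] with respect to [b] at [b = 1]. *)
Lemma mean_regular_cauchy_pow :
  mean_regular (fun x => / (1 + x * x)) ->
  forall k, mean_regular (fun x => (/ (1 + x * x)) ^ S k).
Proof.
  intros Hv. set (v := fun x => / (1 + x * x)) in *.
  assert (v01 : forall x, 0 < v x <= 1).
  { intros x. unfold v. split; [apply Rinv_0_lt_compat; nra|].
    rewrite <- Rinv_1 at 2. apply Rinv_le_contravar; nra. }
  assert (vpow : forall k x, 0 <= v x ^ S k <= v x).
  { intros k x. specialize (v01 x). split; [apply pow_le; lra|].
    simpl. rewrite <- (Rmult_1_r (v x)) at 3. apply Rmult_le_compat_l; [lra|].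
    rewrite <- (pow1 k). apply pow_incr. lra. }
  induction k as [|k IH].
  { apply (mean_regular_ext v); [intros; simpl; unfold v; ring|exact Hv]. }
  change (fun x => (/ (1 + x * x)) ^ S (S k)) with (fun x => v x ^ S (S k)).
  change (fun x => (/ (1 + x * x)) ^ S k) with (fun x => v x ^ S k) in IH.
  apply mean_regular_closed.
  { destruct (proj1 Hv) as [C HC]. exists C. intros x Hx. specialize (HC x Hx).
    pose proof (vpow (S k) x). rewrite Rabs_pos_eq in * by lra. lra. }
  intros eps Heps. set (K := INR (S k)).
  assert (HK : 1 <= K) by (unfold K; rewrite S_INR; pose proof (pos_INR k); lra).
  set (t := eps / (4 * K)). assert (Ht : 0 < t) by (apply Rdiv_lt_0_compat; lra).
  (* With [z = 1 - v], the dilation by [sqrt (1 + t)] replaces [v] by [v / (1 + t z)], whose power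
     [K] is [v^K (1 - K t z)] up to second order. The combination is thus close to
     [v^K (1 - z) = v^(K+1)], with error at most [K t v z <= 4 K t * weight x = eps * weight x]. *)
  exists (fun x => (1 - / (K * t)) * v x ^ S k + / (K * t) * v (sqrt (1 + t) * x) ^ S k).
  split.
  { apply mean_regular_plus; apply mean_regular_scal; [exact IH|].
    apply (mean_regular_dilate (sqrt (1 + t)) (fun x => v x ^ S k)); [|exact IH].
    apply sqrt_lt_R0. lra. }
  intros x Hx. specialize (v01 x). set (z := 1 - v x).
  assert (Hz : 0 <= z <= 1) by (unfold z; lra).
  assert (Ez : x * x * v x = z) by (unfold z, v; field; nra).
  set (r := / (1 + t * z)).
  assert (Er : v (sqrt (1 + t) * x) = v x * r).
  { unfold v at 1. replace (sqrt (1 + t) * x * (sqrt (1 + t) * x)) with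
      (sqrt (1 + t) * sqrt (1 + t) * (x * x)) by ring.
    rewrite sqrt_sqrt by lra. unfold r. rewrite <- Ez. unfold v. field.
    repeat split; nra. }
  rewrite Er, Rpow_mult_distr.
  destruct (inv_1_plus_pow_bounds (t * z) (S k) ltac:(nra)) as [Hr1 Hr2]. fold r K in Hr1, Hr2.
  set (rho := r ^ S k - 1 + K * (t * z)) in *.
  replace (v x ^ S (S k) - ((1 - / (K * t)) * v x ^ S k + / (K * t) * (v x ^ S k * r ^ S k)))
    with (- (v x ^ S k * (rho / (K * t)))).
  2:{ unfold rho, z. change (v x ^ S (S k)) with (v x * v x ^ S k). field. split; lra. }
  rewrite Rabs_Ropp, Rabs_pos_eq.
  2:{ apply Rmult_le_pos; [apply vpow|]. apply Rdiv_le_0_compat; nra. }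
  apply Rle_trans with (v x * (K * t * z)).
  { apply Rmult_le_compat; [apply vpow| |apply vpow|].
    - apply Rdiv_le_0_compat; nra.
    - apply div_le_of_mult; [nra|]. eapply Rle_trans; [exact Hr2|].
      replace (K ^ 2 * (t * z) ^ 2) with ((K * t) ^ 2 * z * z) by ring.
      replace (K * t * z * (K * t)) with ((K * t) ^ 2 * z * 1) by ring.
      apply Rmult_le_compat_l; [|lra]. apply Rmult_le_pos; [apply pow2_ge_0|lra]. }
  replace (v x * (K * t * z)) with (K * t * (v x * z)) by ring.
  replace eps with (K * t * 4) by (unfold t; field; lra).
  rewrite (Rmult_assoc (K * t)).
  apply Rmult_le_compat_l; [nra|]. rewrite <- (Rmult_1_r 4).
  assert (Hxv : x * v x <= 1).
  { unfold v. apply div_le_of_mult; nra. }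
  assert (Hxv0 : 0 <= x * v x) by (apply Rmult_le_pos; lra).
  apply weight_ge; [exact Hx|nra| |].
  - rewrite <- Ez. replace (v x * (x * x * v x)) with (x * (v x * (x * v x))) by ring. nra.
  - nra.
Qed.

Lemma mean_regular_of_cauchy :
  mean_regular (fun x => / (1 + x * x)) -> forall phi, admissible phi -> mean_regular phi.
Proof.
  intros Hv.
  apply (mean_regular_of_powers (fun x => / (1 + x * x)) (fun t => sqrt (/ t - 1))).
  - field.
  - intros x Hx. split; [apply Rinv_0_lt_compat; nra|].
    rewrite <- Rinv_1 at 2. apply Rinv_lt_contravar; nra.
  - intros x y Hxy. apply Rinv_le_contravar; nra.
  - intros t Ht.
    assert (Hi : 1 < / t) by (rewrite <- Rinv_1 at 1; apply Rinv_lt_contravar; lra).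
    repeat split.
    + apply sqrt_lt_R0. lra.
    + rewrite sqrt_sqrt by lra. field. lra.
    + apply (continuity_pt_comp (fun t => / t - 1) sqrt).
      * apply continuity_pt_of_is_derive with (d := - / (t * t)). auto_derive; [lra|]. field. lra.
      * apply continuity_pt_sqrt. lra.
  - intros x Hx. rewrite Rinv_inv. replace (1 + x * x - 1) with (x * x) by ring.
    apply sqrt_square. lra.
  - apply admissible_cauchy.
  - now apply mean_regular_cauchy_pow.
Qed.

(** Means converging uniformly in [u] may be integrated over [[0, r]]. The exchange of sum and
    integral is made for finite partial sums, whose tails are bounded by those of [V] uniformly in
    [u]; then the number of terms tends to infinity. *)
Lemma mean_regular_integral (k : R -> R -> R) (r C : R) :
  0 <= r ->
  (forall y, 0 <= y -> continuity (k y)) ->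
  (forall y u, 0 <= y -> 0 <= u <= r -> Rabs (k y u) <= C / (1 + y)) ->
  (forall eps, 0 < eps -> exists d, 0 < d /\ forall h u, 0 < h < d -> 0 <= u <= r ->
     Rabs (Series (fun n => a n * k (lam n * h) u) - k 0 u * l) <= eps) ->
  mean_regular (fun y => RInt (k y) 0 r).
Proof.
  intros Hr Ck Bk Lk. split.
  - exists (r * C). intros y Hy. unfold Rdiv. rewrite Rmult_assoc.
    replace r with (r - 0) at 2 by ring.
    apply abs_RInt_le_const; [exact Hr|apply ex_RInt_of_continuity; auto|].
    intros u Hu. now apply Bk.
  - intros eps Heps.
    destruct (Lk (eps / (r + 1))) as (d & Hd & H).
    { apply Rdiv_lt_0_compat; lra. }
    exists d. split; [exact Hd|]. intros h Hh.
    assert (Hlh : forall n, 0 <= lam n * h) by (intros n; specialize (lam_ge0 n); nra).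
    set (V := fun n => C * (Rabs (a n) / (1 + lam n * h))).
    assert (EV : ex_series V).
    { apply (ex_series_scal (K := R_AbsRing) (V := R_NormedModule) C
        (fun n => Rabs (a n) / (1 + lam n * h))). apply ex_series_over_1_plus. lra. }
    assert (HV : forall u, 0 <= u <= r -> forall n, Rabs (a n * k (lam n * h) u) <= V n).
    { intros u Hu n. unfold V. rewrite Rabs_mult.
      replace (C * (Rabs (a n) / (1 + lam n * h))) with (Rabs (a n) * (C / (1 + lam n * h)))
        by (unfold Rdiv; ring).
      apply Rmult_le_compat_l; [apply Rabs_pos|]. now apply Bk. }
    set (f := fun N u => sum_n (fun n => a n * k (lam n * h) u) N).
    assert (Cf : forall N, continuity (f N)).
    { induction N as [|N IH].
      - intros u. apply (continuity_pt_ext (fun u => a 0%nat * k (lam 0%nat * h) u)).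
        + intros z. unfold f. now rewrite sum_O.
        + apply (continuity_pt_scal (k (lam 0%nat * h))). now apply Ck.
      - intros u. apply (continuity_pt_ext (fun u => f N u + a (S N) * k (lam (S N) * h) u)).
        + intros z. unfold f. now rewrite sum_Sn.
        + apply (continuity_pt_plus (f N)); [apply IH|].
          apply (continuity_pt_scal (k (lam (S N) * h))). now apply Ck. }
    assert (Ef : forall N, sum_n (fun n => a n * RInt (k (lam n * h)) 0 r) N = RInt (f N) 0 r).
    { assert (Es : forall n, RInt (fun u => a n * k (lam n * h) u) 0 r
                             = a n * RInt (k (lam n * h)) 0 r).
      { intros n. apply (RInt_scal (V := R_CompleteNormedModule) (k (lam n * h))).
        apply ex_RInt_of_continuity; auto. }
      induction N as [|N IH].
      - rewrite sum_O, <- Es. apply RInt_ext. intros u _. unfold f. now rewrite sum_O.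
      - rewrite sum_Sn, IH, <- Es.
        rewrite <- (RInt_plus (V := R_CompleteNormedModule)).
        + apply RInt_ext. intros u _. unfold f. now rewrite sum_Sn.
        + apply ex_RInt_of_continuity, Cf.
        + apply ex_RInt_of_continuity. intros u.
          apply (continuity_pt_scal (k (lam (S N) * h))). now apply Ck. }
    assert (E0 : RInt (k 0) 0 r * l = RInt (fun u => k 0 u * l) 0 r).
    { rewrite Rmult_comm. transitivity (RInt (fun u => l * k 0 u) 0 r).
      - symmetry. apply (RInt_scal (V := R_CompleteNormedModule) (k 0)).
        apply ex_RInt_of_continuity, Ck. lra.
      - apply RInt_ext. intros u _. apply Rmult_comm. }
    assert (HN : forall N, Rabs (sum_n (fun n => a n * RInt (k (lam n * h)) 0 r) N -
       RInt (k 0) 0 r * l) <= r * (eps / (r + 1) + (Series V - sum_n V N))).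
    { intros N. rewrite Ef, E0.
      assert (C0 : continuity (fun u => k 0 u * l)).
      { intros u. apply (continuity_pt_mult (k 0) (fun _ => l)); [now apply Ck; lra|].
        apply continuity_pt_const. intros ? ?; reflexivity. }
      rewrite <- (RInt_minus (V := R_CompleteNormedModule) (f N));
        [|now apply ex_RInt_of_continuity..].
      replace r with (r - 0) at 2 by ring.
      apply abs_RInt_le_const; [exact Hr| |].
      - apply (ex_RInt_minus (V := R_NormedModule) (f N)); now apply ex_RInt_of_continuity.
      - intros u Hu. specialize (H h u Hh Hu).
        pose proof (Series_minus_partial_le _ V (HV u Hu) EV N) as Ht.
        change (minus (f N u) (k 0 u * l)) with (f N u - k 0 u * l).
        replace (f N u - k 0 u * l) with
          ((Series (fun n => a n * k (lam n * h) u) - k 0 u * l) -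
           (Series (fun n => a n * k (lam n * h) u) - f N u)) by ring.
        eapply Rle_trans; [apply Rabs_triang|]. rewrite Rabs_Ropp.
        apply Rplus_le_compat; [exact H|exact Ht]. }
    assert (Em : ex_series (fun n => a n * RInt (k (lam n * h)) 0 r)).
    { apply (Series_dominated _ (fun n => r * V n)).
      - intros n. unfold V. rewrite Rabs_mult.
        replace (r * (C * (Rabs (a n) / (1 + lam n * h)))) with
          (Rabs (a n) * ((r - 0) * (C / (1 + lam n * h)))) by (unfold Rdiv; ring).
        apply Rmult_le_compat_l; [apply Rabs_pos|].
        apply abs_RInt_le_const; [exact Hr|apply ex_RInt_of_continuity; auto|].
        intros u Hu. now apply Bk.
      - now apply (ex_series_scal (K := R_AbsRing) (V := R_NormedModule) r V). }
    apply Rle_trans with (r * (eps / (r + 1))).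
    + assert (L1 : is_lim_seq (fun N => Rabs (sum_n (fun n => a n * RInt (k (lam n * h)) 0 r) N -
        RInt (k 0) 0 r * l)) (Rabs (mean (fun y => RInt (k y) 0 r) h - RInt (k 0) 0 r * l))).
      { apply (is_lim_seq_abs _ (Finite _)).
        apply is_lim_seq_minus'; [|apply is_lim_seq_const].
        exact (Series_correct _ Em). }
      assert (L2 : is_lim_seq (fun N => r * (eps / (r + 1) + (Series V - sum_n V N)))
        (r * (eps / (r + 1) + (Series V - Series V)))).
      { apply (is_lim_seq_scal_l _ r (Finite _)).
        apply is_lim_seq_plus'; [apply is_lim_seq_const|].
        apply is_lim_seq_minus'; [apply is_lim_seq_const|]. exact (Series_correct _ EV). }
      rewrite Rminus_diag, Rplus_0_r in L2.
      exact (is_lim_seq_le _ _ _ _ HN L1 L2).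
    + replace (r * (eps / (r + 1))) with (eps * (r / (r + 1))) by (field; lra).
      rewrite <- (Rmult_1_r eps) at 2. apply Rmult_le_compat_l; [lra|].
      apply div_le_of_mult; lra.
Qed.

(** Divided by its mass, which is at least [c], the average truncated at [r] approximates [phi] with
    error at most [4 B / (c r)] relative to [weight]; [r] is taken large enough to make this at most
    [eps]. *)
Lemma mean_regular_of_integrals (k : R -> R -> R) (phi : R -> R) (B c : R) :
  0 < B -> 0 < c -> decays phi ->
  (forall r, 1 <= r -> mean_regular (fun y => RInt (k y) 0 r)) ->
  (forall r, 1 <= r -> c <= RInt (k 0) 0 r) ->
  (forall r x, 1 <= r -> 0 <= x ->
     let d := Rabs (RInt (k x) 0 r - RInt (k 0) 0 r * phi x) in d <= B / r * x /\ d * x <= B / r) ->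
  mean_regular phi.
Proof.
  intros HB Hc Hphi Hreg Hlow Happ. apply mean_regular_closed; [exact Hphi|].
  intros eps Heps. set (r := Rmax 1 (4 * B / (c * eps))).
  assert (Hce : 0 < c * eps) by nra.
  assert (Hr : 1 <= r) by apply Rmax_l.
  assert (Hr2 : 4 * B <= r * (c * eps)).
  { apply Rle_div_l; [exact Hce|]. apply Rmax_r. }
  specialize (Hlow r Hr). set (A := RInt (k 0) 0 r) in *.
  exists (fun y => / A * RInt (k y) 0 r). split; [now apply mean_regular_scal, Hreg|].
  intros x Hx. destruct (Happ r x Hr Hx) as [H1 H2]. fold A in H1, H2.
  set (d := Rabs (RInt (k x) 0 r - A * phi x)) in *.
  replace (Rabs (phi x - / A * RInt (k x) 0 r)) with (d / A).
  2:{ unfold d. rewrite (Rabs_minus_sym (phi x)).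
      replace (/ A * RInt (k x) 0 r - phi x) with ((RInt (k x) 0 r - A * phi x) * / A)
        by (field; lra).
      rewrite Rabs_mult, (Rabs_pos_eq (/ A)); [reflexivity|].
      left. apply Rinv_0_lt_compat. lra. }
  apply div_le_of_mult; [lra|].
  pose proof (weight_ge0 x) as Hw.
  apply Rle_trans with (4 * (B / r) * weight x).
  { apply weight_ge; auto. apply Rabs_pos. }
  apply Rle_trans with (c * eps * weight x).
  - apply Rmult_le_compat_r; [exact Hw|].
    replace (4 * (B / r)) with (4 * B / r) by (field; lra).
    apply div_le_of_mult; lra.
  - assert (0 <= eps * weight x) by nra. nra.
Qed.

(** For [u > 0] the kernel [exp (- u) young_cos k y u] is [exp (- u) u^k] times the Young function
    dilated by [u]. Since [u <= r], the dilated parameter [h u] is small uniformly, so its means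
    converge uniformly in [u]. *)
Lemma mean_regular_cauchy_of_young (k : R) :
  1 <= k -> mean_regular (young k) -> mean_regular (fun x => / (1 + x * x)).
Proof.
  intros Hk [_ L]. rewrite young_at_0, Rmult_1_l in L.
  assert (Hc : forall y, continuity (fun u => exp (- u) * young_cos k y u)).
  { intros y u. apply continuity_pt_mult; [apply continuity_exp_opp|now apply continuity_young_cos]. }
  destruct (pw_mul_exp_bounded (k + 1) ltac:(lra)) as (B & HB & HBx).
  destruct (RInt_pos_lower_bound (fun u => exp (- u) * young_cos k 0 u)) as (c & Hc0 & Hlow).
  { apply Hc. }
  { intros u Hu. apply Rmult_lt_0_compat; [apply exp_pos|].
    rewrite young_cos_0l by lra. now apply pw_pos. }
  apply (mean_regular_of_integrals (fun y u => exp (- u) * young_cos k y u) _ (2 * B) c).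
  - lra.
  - exact Hc0.
  - destruct admissible_cauchy as [[C HC] _]. exists C. intros x Hx. now apply HC.
  - intros r Hr.
    assert (Hpr : 0 <= pw r (k - 1)) by apply pw_ge0.
    apply (mean_regular_integral _ r (2 * k * pw r (k - 1) * (r + 1))).
    + lra.
    + intros y _. apply Hc.
    + intros y u Hy [[Hu|<-] Hur].
      * rewrite Rabs_mult, (Rabs_pos_eq (exp _)) by (left; apply exp_pos).
        rewrite <- Rmult_1_l. apply Rmult_le_compat; [left; apply exp_pos|apply Rabs_pos| |].
        -- rewrite <- exp_0. left. apply exp_increasing. lra.
        -- rewrite young_scale by lra. rewrite Rabs_mult, Rabs_pos_eq by apply pw_ge0.
           assert (Hyu : 0 <= y * u) by nra.
           pose proof (young_decay k (y * u) Hk Hyu) as Hdec.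
           apply Rle_trans with (u * pw r (k - 1) * (2 * k / (1 + y * u))).
           { apply Rmult_le_compat; [apply pw_ge0|apply Rabs_pos| |exact Hdec].
             rewrite pw_pred by lra. apply Rmult_le_compat_l; [lra|]. apply pw_le; lra. }
           replace (u * pw r (k - 1) * (2 * k / (1 + y * u))) with
             (2 * k * pw r (k - 1) * (u / (1 + y * u))) by (field; lra).
           replace (2 * k * pw r (k - 1) * (r + 1) / (1 + y)) with
             (2 * k * pw r (k - 1) * ((r + 1) / (1 + y))) by (field; lra).
           apply Rmult_le_compat_l; [nra|].
           apply div_le_of_mult; [lra|].
           replace ((r + 1) / (1 + y) * (1 + y * u)) with ((r + 1) * (1 + y * u) / (1 + y))
             by (field; lra).
           apply le_div_of_mult; [lra|]. nra.
      * rewrite young_cos_0r, Rmult_0_r, Rabs_R0. apply Rdiv_le_0_compat; [|lra].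
        apply Rmult_le_pos; nra.
    + intros eps Heps.
      assert (HP : 0 < pw r k) by (apply pw_pos; lra).
      destruct (L (eps / pw r k)) as (d & Hd & HL); [now apply Rdiv_lt_0_compat|].
      exists (d / r). split; [apply Rdiv_lt_0_compat; lra|].
      intros h u [Hh Hhd] [[Hu|<-] Hur].
      * apply Rlt_div_r in Hhd; [|lra].
        rewrite young_cos_0l by lra.
        rewrite (Series_ext _ (fun n => (exp (- u) * pw u k) * (a n * young k (lam n * (h * u))))).
        2:{ intros n. rewrite young_scale; [|exact Hk| |exact Hu].
            - replace (lam n * h * u) with (lam n * (h * u)) by ring. ring.
            - specialize (lam_ge0 n). nra. }
        rewrite Series_scal_l. fold (mean (young k) (h * u)).
        rewrite <- Rmult_minus_distr_l, Rabs_mult.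
        assert (Hhu : 0 < h * u < d) by nra.
        specialize (HL (h * u) Hhu).
        apply Rle_trans with (pw r k * (eps / pw r k)); [|right; field; lra].
        apply Rmult_le_compat; [apply Rabs_pos|apply Rabs_pos| |exact HL].
        rewrite Rabs_pos_eq by (apply Rmult_le_pos; [left; apply exp_pos|apply pw_ge0]).
        rewrite <- Rmult_1_l. apply Rmult_le_compat; [left; apply exp_pos|apply pw_ge0| |].
        -- rewrite <- exp_0. left. apply exp_increasing. lra.
        -- apply pw_le; lra.
      * rewrite young_cos_0r, (Series_ext _ (fun n => 0 * 0)).
        -- rewrite Series_scal_l, !Rmult_0_r, !Rmult_0_l, Rminus_diag, Rabs_R0. lra.
        -- intros n. rewrite young_cos_0r. ring.
  - exact Hlow.
  - intros r x Hr Hx d.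
    destruct (young_mean_approx k x r Hk Hx Hr) as [H1 H2]. fold d in H1, H2.
    (* [B] bounds [r^(k+2) exp (- r)], and [(1 + r) r <= 2 r^2] accounts for the factor [2]. *)
    assert (HBr : exp (- r) * pw r k * (1 + r) <= 2 * B / r).
    { apply le_div_of_mult; [lra|].
      specialize (HBx r ltac:(lra)). rewrite pw_pred in HBx by lra.
      replace (k + 1 - 1) with k in HBx by ring.
      pose proof (exp_pos (- r)). pose proof (pw_ge0 r k).
      assert (0 <= exp (- r) * pw r k * r * (r - 1)).
      { apply Rmult_le_pos; [|lra]. apply Rmult_le_pos; [|lra]. nra. }
      lra. }
    split; [|lra]. eapply Rle_trans; [exact H1|]. apply Rmult_le_compat_r; assumption.
Qed.

(** For [u > 0], [pw (u - y) b] is [u^b] times the Riesz kernel at [y / u]. The parameter is now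
    [h / u], which need not be small when [u] is, so uniformity near [u = 0] must come from the
    factor [u^b]. *)
Lemma mean_regular_exp_of_riesz (b : R) :
  0 < b -> mean_regular (fun x => pw (1 - x) b) -> mean_regular (fun x => exp (- x)).
Proof.
  intros Hb [[Cr HCr] L]. rewrite Rminus_0_r, pw_base1, Rmult_1_l in L.
  assert (Hc : forall y, continuity (fun u => exp (- u) * pw (u - y) b)).
  { intros y. now apply continuity_exp_pw_shift. }
  destruct (pw_mul_exp_bounded (b + 2) ltac:(lra)) as (B & HB & HBx).
  destruct (RInt_pos_lower_bound (fun u => exp (- u) * pw (u - 0) b)) as (c & Hc0 & Hlow).
  { apply Hc. }
  { intros u Hu. apply Rmult_lt_0_compat; [apply exp_pos|]. apply pw_pos. lra. }
  apply (mean_regular_of_integrals (fun y u => exp (- u) * pw (u - y) b) _ B c).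
  - exact HB.
  - exact Hc0.
  - destruct admissible_exp as [[C HC] _]. exists C. intros x Hx. now apply HC.
  - intros r Hr.
    assert (HP : 0 < pw r b) by (apply pw_pos; lra).
    assert (He1 : forall u, 0 <= u -> 0 <= exp (- u) <= 1).
    { intros u [Hu|<-]; split; try (left; apply exp_pos).
      - rewrite <- exp_0. left. apply exp_increasing. lra.
      - rewrite Ropp_0, exp_0. lra. }
    apply (mean_regular_integral _ r (pw r b * (1 + r))).
    + lra.
    + intros y _. apply Hc.
    + intros y u Hy Hu.
      destruct (Rle_dec y r) as [Hyr|Hyr].
      * rewrite Rabs_pos_eq by (apply Rmult_le_pos; [apply He1; lra|apply pw_ge0]).
        apply Rle_trans with (1 * pw r b).
        -- apply Rmult_le_compat; [apply He1; lra|apply pw_ge0|apply He1; lra|].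
           apply pw_le; lra.
        -- apply le_div_of_mult; [lra|]. nra.
      * rewrite pw_nonpos_base, Rmult_0_r, Rabs_R0 by lra.
        apply Rdiv_le_0_compat; nra.
    + intros eps Heps.
      (* [mean - l] is bounded on all of [(0, oo)], which handles small [u] because [u^b -> 0] *)
      assert (HE : exists E, 0 < E /\
        forall y, 0 < y -> Rabs (mean (fun x => pw (1 - x) b) y - l) <= E).
      { destruct (L 1 ltac:(lra)) as (d1 & Hd1 & HL1).
        set (V := fun n => Cr * (Rabs (a n) / (1 + lam n * (d1 / 2)))).
        assert (EV : ex_series V).
        { apply (ex_series_scal (K := R_AbsRing) (V := R_NormedModule) Cr
            (fun n => Rabs (a n) / (1 + lam n * (d1 / 2)))). apply ex_series_over_1_plus. lra. }
        assert (HV0 : 0 <= Rabs (Series V)) by apply Rabs_pos.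
        pose proof (Rabs_pos l) as Hl0.
        exists (1 + Rabs (Series V) + Rabs l). split; [lra|]. intros y Hy.
        destruct (Rlt_dec y d1) as [Hyd|Hyd].
        - specialize (HL1 y (conj Hy Hyd)). lra.
        - assert (Hm : Rabs (mean (fun x => pw (1 - x) b) y) <= Series V).
          { apply Series_dominated; [|exact EV]. intros n.
            eapply Rle_trans; [exact (mean_terms_dominated (fun x => pw (1 - x) b) Cr y Hy HCr n)|].
            unfold V.
            assert (HCr0 : 0 <= Cr).
            { specialize (HCr 0 (Rle_refl 0)). rewrite Rplus_0_r, Rdiv_1_r in HCr.
              eapply Rle_trans; [apply Rabs_pos|exact HCr]. }
            apply Rmult_le_compat_l; [exact HCr0|]. apply Rmult_le_compat_l; [apply Rabs_pos|].
            specialize (lam_ge0 n). apply Rinv_le_contravar; [nra|]. nra. }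
          eapply Rle_trans; [apply Rabs_triang|]. rewrite Rabs_Ropp.
          pose proof (Rle_abs (Series V)). lra. }
      destruct HE as (E & HE0 & HE).
      assert (Hpos : 0 < eps / E) by now apply Rdiv_lt_0_compat.
      (* The threshold solves [eta^b E = eps]. Above it, [h < d * eta] gives [h / u < d], so
         convergence of the means applies. *)
      set (eta := Rpower (eps / E) (/ b)).
      assert (Heta : 0 < eta) by apply Rpower_pos.
      assert (Heta2 : pw eta b = eps / E).
      { rewrite pw_Rpower by exact Heta. unfold eta.
        rewrite Rpower_mult, Rinv_l by lra. now apply Rpower_1. }
      destruct (L (eps / pw r b)) as (d & Hd & HL); [now apply Rdiv_lt_0_compat|].
      exists (d * eta). split; [nra|].
      intros h u [Hh Hhd] [[Hu|<-] Hur].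
      * rewrite Rminus_0_r.
        rewrite (Series_ext _ (fun n => (exp (- u) * pw u b) * (a n * pw (1 - lam n * (h / u)) b))).
        2:{ intros n. replace (lam n * (h / u)) with (lam n * h / u) by (field; lra).
            replace (u - lam n * h) with ((1 - lam n * h / u) * u) by (field; lra).
            rewrite pw_mult by exact Hu. ring. }
        rewrite Series_scal_l. fold (mean (fun x => pw (1 - x) b) (h / u)).
        rewrite <- Rmult_minus_distr_l, Rabs_mult.
        assert (Hhu : 0 < h / u) by now apply Rdiv_lt_0_compat.
        rewrite Rabs_pos_eq by (apply Rmult_le_pos; [left; apply exp_pos|apply pw_ge0]).
        assert (Hle : exp (- u) * pw u b <= pw u b).
        { rewrite <- Rmult_1_l. apply Rmult_le_compat_r; [apply pw_ge0|]. apply He1. lra. }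
        destruct (Rle_dec u eta) as [Hue|Hue].
        -- apply Rle_trans with (pw eta b * E).
           ++ apply Rmult_le_compat; [apply Rmult_le_pos; [left; apply exp_pos|apply pw_ge0]
                |apply Rabs_pos| |now apply HE].
              eapply Rle_trans; [exact Hle|]. apply pw_le; lra.
           ++ rewrite Heta2. right. field. lra.
        -- apply Rle_trans with (pw r b * (eps / pw r b)); [|right; field; lra].
           apply Rmult_le_compat; [apply Rmult_le_pos; [left; apply exp_pos|apply pw_ge0]
                |apply Rabs_pos| |].
           ++ eapply Rle_trans; [exact Hle|]. apply pw_le; lra.
           ++ apply HL. split; [exact Hhu|]. apply Rlt_div_l; [exact Hu|]. nra.
      * rewrite (Series_ext _ (fun n => 0 * 0)).
        -- rewrite Series_scal_l, (pw_nonpos_base (0 - 0)), !Rmult_0_r, !Rmult_0_l,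
             Rminus_diag, Rabs_R0 by lra. lra.
        -- intros n. rewrite pw_nonpos_base; [ring| |lra]. specialize (lam_ge0 n). nra.
  - exact Hlow.
  - intros r x Hr Hx d.
    now apply (riesz_mean_approx b x r B).
Qed.

Lemma mean_regular_transfer (phi : R -> R) : admissible phi ->
  (forall k, 1 <= k -> mean_regular (young k) -> mean_regular phi) /\
  (forall b, 0 < b -> mean_regular (fun x => pw (1 - x) b) -> mean_regular phi) /\
  (mean_regular (fun x => exp (- x)) -> mean_regular phi).
Proof.
  intros Hphi. split; [|split].
  - intros k Hk H. apply mean_regular_of_cauchy; [|exact Hphi].
    now apply (mean_regular_cauchy_of_young k).
  - intros b Hb H. apply mean_regular_of_exp; [|exact Hphi].
    now apply (mean_regular_exp_of_riesz b).
  - intros H. now apply mean_regular_of_exp.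
Qed.

End Means.

(** * Reduction to real series *)

Lemma filterlim_C_iff {T : Type} (F : (T -> Prop) -> Prop) {FF : Filter F} (f : T -> C) (l : C) :
  filterlim f F (locally l) <->
  filterlim (fun x => Re (f x)) F (locally (Re l)) /\
  filterlim (fun x => Im (f x)) F (locally (Im l)).
Proof.
  split.
  - intros H. split; intros P [e HP].
    + apply (H (fun z => P (Re z))). exists e. intros z Hz. apply HP, Hz.
    + apply (H (fun z => P (Im z))). exists e. intros z Hz. apply HP, Hz.
  - intros [H1 H2] P [e HP].
    specialize (H1 (fun z => ball (Re l) e z) (ex_intro _ e (fun _ Hz => Hz))).
    specialize (H2 (fun z => ball (Im l) e z) (ex_intro _ e (fun _ Hz => Hz))).
    unfold filtermap in *. generalize (filter_and _ _ H1 H2). apply filter_imp.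
    intros x [Hx1 Hx2]. apply HP. split; assumption.
Qed.

Lemma ex_series_C (u : nat -> C) :
  ex_series (fun n => Re (u n)) -> ex_series (fun n => Im (u n)) -> ex_series u.
Proof.
  intros [s1 H1] [s2 H2]. exists (s1, s2).
  apply (filterlim_C_iff eventually (sum_n u) (s1, s2)).
  assert (E : forall n, Re (sum_n u n) = sum_n (fun n => Re (u n)) n /\
                        Im (sum_n u n) = sum_n (fun n => Im (u n)) n).
  { induction n as [|n [IH1 IH2]]; [now rewrite !sum_O|].
    rewrite !sum_Sn, <- IH1, <- IH2. split; reflexivity. }
  split.
  - apply (filterlim_ext (sum_n (fun n => Re (u n)))); [|exact H1]. intros n. symmetry. apply E.
  - apply (filterlim_ext (sum_n (fun n => Im (u n)))); [|exact H2]. intros n. symmetry. apply E.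
Qed.

Lemma filterlim_p_infty_lim0 (f : R -> R) (y : R) :
  filterlim f (Rbar_locally p_infty) (locally y) <-> lim0 (fun h => f (/ h)) y.
Proof.
  split.
  - intros H e He.
    destruct (H (fun z => Rabs (z - y) < e)) as [A HA].
    { exists (mkposreal e He). intros z Hz. exact Hz. }
    assert (HB : 0 < Rmax A 1) by (eapply Rlt_le_trans; [apply Rlt_0_1|apply Rmax_r]).
    exists (/ Rmax A 1). split; [now apply Rinv_0_lt_compat|]. intros h [Hh0 Hh].
    left. apply HA. apply Rle_lt_trans with (Rmax A 1); [apply Rmax_l|].
    rewrite <- (Rinv_inv (Rmax A 1)). apply Rinv_lt_contravar; [|exact Hh].
    apply Rmult_lt_0_compat; [exact Hh0|]. now apply Rinv_0_lt_compat.
  - intros H P [e HP]. pose proof (cond_pos e).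
    destruct (H (e / 2) ltac:(lra)) as (d & Hd & Hf).
    exists (/ d). intros x Hx. apply HP. change (Rabs (f x - y) < e).
    assert (Hd' : 0 < / d) by now apply Rinv_0_lt_compat.
    rewrite <- (Rinv_inv x). apply Rle_lt_trans with (e / 2); [|lra]. apply Hf. split.
    + apply Rinv_0_lt_compat. lra.
    + rewrite <- (Rinv_inv d). apply Rinv_lt_contravar; [|exact Hx]. nra.
Qed.

Lemma Series_eventually_0 (u : nat -> R) (N : nat) :
  (forall n, (N < n)%nat -> u n = 0) -> Series u = sum_n u N.
Proof.
  intros H. apply is_series_unique.
  enough (L : is_lim_seq (sum_n u) (sum_n u N)) by exact L.
  apply (is_lim_seq_ext_loc (fun _ => sum_n u N)); [|apply is_lim_seq_const].
  exists N. intros n Hn. induction Hn as [|n Hn IH]; [reflexivity|].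
  rewrite sum_Sn, <- IH, H by lia. symmetry. apply Rplus_0_r.
Qed.

Lemma sum_n_le_sum_n (u : nat -> R) (n m : nat) :
  (forall k, 0 <= u k) -> (n <= m)%nat -> sum_n u n <= sum_n u m.
Proof.
  intros H Hnm. induction Hnm as [|m Hm IH]; [lra|].
  rewrite sum_Sn. unfold plus; simpl. specialize (H (S m)). lra.
Qed.

Section Reduction.

Context (lam : nat -> R) (c : nat -> C).
Context (lam_ge0 : forall n, 0 <= lam n).
Context (lam_incr : forall n, lam n < lam (S n)).

Lemma lam_le (n m : nat) : (n <= m)%nat -> lam n <= lam m.
Proof.
  intros H. induction H as [|m Hm IH]; [lra|]. specialize (lam_incr m). lra.
Qed.

(** The hypothesis is read at [x = lam n], where the sum is the partial sum up to [n] by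
    monotonicity of [lam]. The finitely many [n] with [lam n] possibly below [X] are bounded by a
    later partial sum, which the [1] in [1 + lam n] absorbs. *)
Lemma partial_sums_bounded :
  is_lim_seq lam p_infty ->
  (exists M X, forall x, X <= x ->
     Rabs (sum_le_R lam (fun n => lam n * Cmod (c n)) x) <= M * Rabs x) ->
  exists M, forall n, sum_n (fun k => lam k * Cmod (c k)) n <= M * (1 + lam n).
Proof.
  intros Hlim (M & X & HM).
  set (u := fun k => lam k * Cmod (c k)).
  assert (Hu : forall k, 0 <= u k).
  { intros k. apply Rmult_le_pos; [apply lam_ge0|apply Cmod_ge_0]. }
  assert (Hsum : forall n, sum_le_R lam u (lam n) = sum_n u n).
  { intros n. unfold sum_le_R. rewrite (Series_eventually_0 _ n).
    - apply sum_n_ext_loc. intros k Hk.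
      destruct (Rle_dec (lam k) (lam n)) as [|Hn]; [reflexivity|].
      exfalso. apply Hn. now apply lam_le.
    - intros k Hk. destruct (Rle_dec (lam k) (lam n)) as [Hle|]; [|reflexivity].
      pose proof (lam_incr n). pose proof (lam_le (S n) k Hk). lra. }
  assert (Hbig : forall n, X <= lam n -> sum_n u n <= Rabs M * lam n).
  { intros n Hn. specialize (HM (lam n) Hn). fold u in HM.
    rewrite Hsum, (Rabs_pos_eq (lam n)) in HM by apply lam_ge0.
    eapply Rle_trans; [apply Rle_abs|]. eapply Rle_trans; [exact HM|].
    apply Rmult_le_compat_r; [apply lam_ge0|apply Rle_abs]. }
  destruct (proj2 (is_lim_seq_spec lam p_infty) Hlim X) as [N HN].
  pose proof (lam_ge0 N) as HN0. pose proof (Rabs_pos M) as HM0.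
  assert (H0 : 0 <= Rabs M * lam N) by now apply Rmult_le_pos.
  exists (Rabs M * (1 + lam N)). intros n.
  pose proof (lam_ge0 n) as Hn0.
  assert (H1 : 0 <= Rabs M * lam n) by now apply Rmult_le_pos.
  assert (H2 : 0 <= Rabs M * lam N * lam n) by now apply Rmult_le_pos.
  destruct (Nat.le_gt_cases N n) as [Hn|Hn].
  - specialize (Hbig n (Rlt_le _ _ (HN n Hn))). lra.
  - pose proof (sum_n_le_sum_n u n N Hu ltac:(lia)) as Hle.
    specialize (Hbig N (Rlt_le _ _ (HN N (Nat.le_refl N)))). lra.
Qed.

Context (M : R).
Context (HM : forall n, sum_n (fun k => lam k * Cmod (c k)) n <= M * (1 + lam n)).

Lemma sum_bound_of_le_Cmod (a : nat -> R) :
  (forall n, Rabs (a n) <= Cmod (c n)) ->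
  forall n, sum_n (fun k => lam k * Rabs (a k)) n <= M * (1 + lam n).
Proof.
  intros H n. eapply Rle_trans; [|apply HM]. apply sum_n_m_le. intros k.
  apply Rmult_le_compat_l; [apply lam_ge0|apply H].
Qed.

Lemma sum_bound_Re : forall n, sum_n (fun k => lam k * Rabs (Re (c k))) n <= M * (1 + lam n).
Proof. apply sum_bound_of_le_Cmod. intros n. apply re_le_Cmod. Qed.

Lemma sum_bound_Im : forall n, sum_n (fun k => lam k * Rabs (Im (c k))) n <= M * (1 + lam n).
Proof.
  apply sum_bound_of_le_Cmod. intros n.
  eapply Rle_trans; [|apply Rmax_Cmod]. apply Rmax_r.
Qed.

Definition C_regular (phi : R -> R) (l : C) : Prop :=
  mean_regular lam (fun n => Re (c n)) (Re l) phi /\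
  mean_regular lam (fun n => Im (c n)) (Im l) phi.

Lemma Re_mult_RtoC (z : C) (x : R) : Re (z * RtoC x)%C = Re z * x.
Proof. destruct z as [p q]. simpl. ring. Qed.

Lemma Im_mult_RtoC (z : C) (x : R) : Im (z * RtoC x)%C = Im z * x.
Proof. destruct z as [p q]. simpl. ring. Qed.

(** Supplies the convergence clauses in [gamma_summable] and [Abel_summable]. *)
Lemma ex_series_C_mean (phi : R -> R) (h : R) :
  decays phi -> 0 < h -> ex_series (fun n => (c n * RtoC (phi (lam n * h)%R))%C).
Proof.
  intros Hphi Hh. apply ex_series_C.
  - apply (ex_series_ext (fun n => Re (c n) * phi (lam n * h))).
    + intros n. symmetry. apply Re_mult_RtoC.
    + exact (ex_series_mean lam _ lam_ge0 lam_incr M sum_bound_Re phi h Hphi Hh).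
  - apply (ex_series_ext (fun n => Im (c n) * phi (lam n * h))).
    + intros n. symmetry. apply Im_mult_RtoC.
    + exact (ex_series_mean lam _ lam_ge0 lam_incr M sum_bound_Im phi h Hphi Hh).
Qed.

Lemma C_regular_iff (phi : R -> R) (l : C) :
  decays phi -> phi 0 = 1 ->
  (C_regular phi l <->
   filterlim (fun h => CSeries (fun n => (c n * RtoC (phi (lam n * h)%R))%C)) (at_right 0) (locally l)).
Proof.
  intros Hphi H0. unfold C_regular, mean_regular. rewrite H0, !Rmult_1_l.
  rewrite (filterlim_C_iff (at_right 0)), <- !lim0_filterlim. simpl.
  assert (E1 : forall h, Series (fun n => Re (c n * RtoC (phi (lam n * h)%R))%C) =
                         mean lam (fun n => Re (c n)) phi h).
  { intros h. apply Series_ext. intros n. apply Re_mult_RtoC. }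
  assert (E2 : forall h, Series (fun n => Im (c n * RtoC (phi (lam n * h)%R))%C) =
                         mean lam (fun n => Im (c n)) phi h).
  { intros h. apply Series_ext. intros n. apply Im_mult_RtoC. }
  split.
  - intros [[_ L1] [_ L2]]. split.
    + apply (lim0_ext (mean lam (fun n => Re (c n)) phi)); [|exact L1]. intros h _. symmetry. apply E1.
    + apply (lim0_ext (mean lam (fun n => Im (c n)) phi)); [|exact L2]. intros h _. symmetry. apply E2.
  - intros [L1 L2]. repeat split; try exact Hphi.
    + eapply lim0_ext; [|exact L1]. intros h _. apply E1.
    + eapply lim0_ext; [|exact L2]. intros h _. apply E2.
Qed.

Lemma decays_of_admissible (phi : R -> R) : admissible phi -> decays phi.
Proof. intros [[C HC] _]. exists C. intros x Hx. now apply HC. Qed.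

Lemma gamma_summable_iff (k : R) (l : C) : 1 <= k ->
  (gamma_summable lam c k l <-> C_regular (young k) l).
Proof.
  intros Hk. pose proof (decays_of_admissible _ (admissible_young k Hk)) as Hd.
  rewrite (C_regular_iff _ l Hd (young_at_0 k)). split.
  - intros [_ H]. exact H.
  - intros H. split; [|exact H]. exists 1. split; [lra|]. intros h Hh.
    now apply (ex_series_C_mean (young k)).
Qed.

Lemma Abel_summable_iff (l : C) :
  Abel_summable lam c l <-> C_regular (fun x => exp (- x)) l.
Proof.
  pose proof (decays_of_admissible _ admissible_exp) as Hd.
  rewrite (C_regular_iff _ l Hd) by (now rewrite Ropp_0, exp_0). split.
  - intros [_ H]. exact H.
  - intros H. split; [|exact H]. intros y Hy. now apply (ex_series_C_mean (fun x => exp (- x))).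
Qed.

(** With [h = 1 / x], the condition [lam n <= x] is built into the kernel: [pw (1 - lam n * h) b]
    vanishes beyond it because [b > 0]. *)
Lemma Riesz_summable_iff (b : R) (l : C) : 0 < b ->
  (Riesz_summable lam c b l <-> C_regular (fun x => pw (1 - x) b) l).
Proof.
  intros Hb. pose proof (decays_of_admissible _ (admissible_riesz b Hb)) as Hd.
  rewrite (C_regular_iff _ l Hd) by (now rewrite Rminus_0_r, pw_base1).
  unfold Riesz_summable.
  rewrite !filterlim_C_iff, !filterlim_p_infty_lim0, <- !lim0_filterlim by typeclasses eauto.
  assert (E : forall h, 0 < h ->
    sum_le lam (fun n => (c n * RtoC (pw (1 - lam n / / h) b))%C) (/ h) =
    CSeries (fun n => (c n * RtoC (pw (1 - lam n * h) b))%C)).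
  { intros h Hh.
    assert (En : forall n, (if Rle_dec (lam n) (/ h)
                            then (c n * RtoC (pw (1 - lam n / / h) b))%C else RtoC 0) =
                           (c n * RtoC (pw (1 - lam n * h) b))%C).
    { intros n. replace (lam n / / h) with (lam n * h) by (field; lra).
      destruct (Rle_dec (lam n) (/ h)) as [|Hn]; [reflexivity|].
      rewrite (pw_nonpos_base (1 - lam n * h)) by
        (try lra; enough (1 <= lam n * h) by lra;
         rewrite <- (Rinv_l h) by lra; apply Rmult_le_compat_r; lra).
      symmetry. apply Cmult_0_r. }
    unfold sum_le, CSeries. f_equal; apply Series_ext; intros n; now rewrite En. }
  split; intros [L1 L2]; split; (eapply lim0_ext; [|eassumption]); intros h Hh; cbv beta;
    now rewrite (E h Hh).
Qed.

Lemma C_regular_transfer (phi : R -> R) (l : C) : admissible phi ->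
  (forall k, 1 <= k -> C_regular (young k) l -> C_regular phi l) /\
  (forall b, 0 < b -> C_regular (fun x => pw (1 - x) b) l -> C_regular phi l) /\
  (C_regular (fun x => exp (- x)) l -> C_regular phi l).
Proof.
  intros Hphi.
  destruct (mean_regular_transfer lam _ (Re l) lam_ge0 lam_incr M sum_bound_Re phi Hphi)
    as (R1 & R2 & R3).
  destruct (mean_regular_transfer lam _ (Im l) lam_ge0 lam_incr M sum_bound_Im phi Hphi)
    as (I1 & I2 & I3).
  split; [|split].
  - intros k Hk [H1 H2]. split; [now apply (R1 k)|now apply (I1 k)].
  - intros b Hb [H1 H2]. split; [now apply (R2 b)|now apply (I2 b)].
  - intros [H1 H2]. split; [now apply R3|now apply I3].
Qed.

(** The series converges absolutely: [|exp (i x h) / (x h)| = 1 / (x |h|)] is at most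
    [K / (1 + x |h|)] for [x >= lam 1]. The sign of [h] is immaterial, and index [0] is split off
    because [lam 0] may be [0]. *)
Lemma ex_series_exp_over (h : R) : 0 < Rabs h ->
  ex_series (fun n => if Rlt_dec 0 (lam n)
                      then (c n * cexpi (lam n * h) / RtoC (lam n * h))%C
                      else RtoC 0).
Proof.
  intros Hh.
  set (z := fun n => if Rlt_dec 0 (lam n)
                     then (c n * cexpi (lam n * h) / RtoC (lam n * h))%C else RtoC 0).
  assert (Hl1 : 0 < lam 1%nat) by (pose proof (lam_ge0 0%nat); pose proof (lam_incr 0%nat); lra).
  set (K := 1 + / (lam 1%nat * Rabs h)).
  assert (Hlh1 : 0 < lam 1%nat * Rabs h) by now apply Rmult_lt_0_compat.
  assert (Hinv : 0 < / (lam 1%nat * Rabs h)) by now apply Rinv_0_lt_compat.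
  assert (Hz : forall n, Cmod (z (S n)) <= K * (Cmod (c (S n)) / (1 + lam (S n) * Rabs h))).
  { intros n. assert (Hl : lam 1%nat <= lam (S n)) by (apply lam_le; lia).
    unfold z. destruct (Rlt_dec 0 (lam (S n))) as [Hp|]; [|lra].
    assert (Hne : lam (S n) * h <> 0).
    { intros E. apply Rmult_integral in E. destruct E as [E|E]; [lra|].
      rewrite E, Rabs_R0 in Hh. lra. }
    rewrite Cmod_div by (intros E; apply Hne; now apply RtoC_inj).
    rewrite Cmod_mult, Cmod_R, Rabs_mult, (Rabs_pos_eq (lam (S n))) by lra.
    replace (Cmod (cexpi (lam (S n) * h))) with 1.
    2:{ unfold Cmod, cexpi. simpl fst. simpl snd. rewrite <- sqrt_1. f_equal.
        pose proof (sin2_cos2 (lam (S n) * h)) as E. unfold Rsqr in E. lra. }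
    rewrite Rmult_1_r.
    replace (K * (Cmod (c (S n)) / (1 + lam (S n) * Rabs h))) with
      (Cmod (c (S n)) * (K / (1 + lam (S n) * Rabs h))) by (unfold Rdiv; ring).
    apply Rmult_le_compat_l; [apply Cmod_ge_0|].
    set (y := lam (S n) * Rabs h).
    assert (Hy : lam 1%nat * Rabs h <= y) by (apply Rmult_le_compat_r; lra).
    apply le_div_of_mult; [lra|]. rewrite Rmult_comm. apply div_le_of_mult; [lra|].
    unfold K.
    assert (1 <= / (lam 1%nat * Rabs h) * y).
    { rewrite <- (Rinv_l (lam 1%nat * Rabs h)) at 1 by lra. apply Rmult_le_compat_l; lra. }
    lra. }
  assert (Hdom : ex_series (fun n => K * (Cmod (c (S n)) / (1 + lam (S n) * Rabs h)))).
  { apply (ex_series_scal (K := R_AbsRing) (V := R_NormedModule) K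
      (fun n => Cmod (c (S n)) / (1 + lam (S n) * Rabs h))).
    apply (ex_series_incr_1 (fun n => Cmod (c n) / (1 + lam n * Rabs h))).
    apply (ex_series_ext (fun n => Rabs (Cmod (c n)) / (1 + lam n * Rabs h))).
    { intros n. now rewrite (Rabs_pos_eq (Cmod (c n))) by apply Cmod_ge_0. }
    apply (ex_series_over_1_plus lam (fun n => Cmod (c n)) lam_ge0 lam_incr M); [|exact Hh].
    apply sum_bound_of_le_Cmod. intros n. rewrite Rabs_pos_eq; [lra|apply Cmod_ge_0]. }
  apply ex_series_C.
  - apply (ex_series_incr_1 (fun n => Re (z n))).
    apply (Series_dominated _ (fun n => K * (Cmod (c (S n)) / (1 + lam (S n) * Rabs h))));
      [|exact Hdom].
    intros n. eapply Rle_trans; [apply re_le_Cmod|apply Hz].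
  - apply (ex_series_incr_1 (fun n => Im (z n))).
    apply (Series_dominated _ (fun n => K * (Cmod (c (S n)) / (1 + lam (S n) * Rabs h))));
      [|exact Hdom].
    intros n. eapply Rle_trans; [|apply Hz].
    eapply Rle_trans; [|apply Rmax_Cmod]. apply Rmax_r.
Qed.

Lemma L_summable_iff (l : C) : L_summable lam c l <-> C_regular (young 1) l.
Proof.
  rewrite <- (gamma_summable_iff 1 l) by lra. split.
  - intros [H _]. exact H.
  - intros H. split; [exact H|]. exists 1. split; [lra|]. intros h Hh.
    apply ex_series_exp_over. lra.
Qed.

End Reduction.

Theorem theorem3p1 (lam : nat -> R) (c : nat -> C) (l : C) :
  (forall n, 0 <= lam n) ->
  (forall n, lam n < lam (S n)) ->
  is_lim_seq lam p_infty ->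
  (exists M X, forall x, X <= x ->
     Rabs (sum_le_R lam (fun n => lam n * Cmod (c n)) x) <= M * Rabs x) ->
  (L_summable lam c l <-> exists kappa, 1 <= kappa /\ gamma_summable lam c kappa l) /\
  (L_summable lam c l <-> forall kappa, 1 <= kappa -> gamma_summable lam c kappa l) /\
  (L_summable lam c l <-> exists beta, 0 < beta /\ Riesz_summable lam c beta l) /\
  (L_summable lam c l <-> forall beta, 0 < beta -> Riesz_summable lam c beta l) /\
  (L_summable lam c l <-> Abel_summable lam c l).
Proof.
  intros Hge0 Hincr Hlim Hbound.
  destruct (partial_sums_bounded lam c Hge0 Hincr Hlim Hbound) as [M HM].
  assert (HL : L_summable lam c l <-> C_regular lam c (young 1) l)
    by now apply (L_summable_iff lam c Hge0 Hincr M).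
  (* Equivalence with [L_summable] is shown for each single parameter, so that the versions with
     some and with all parameters follow together. *)
  assert (Hgamma : forall k, 1 <= k -> (L_summable lam c l <-> gamma_summable lam c k l)).
  { intros k Hk. rewrite HL, (gamma_summable_iff lam c Hge0 Hincr M HM k l Hk). split.
    - apply (C_regular_transfer lam c Hge0 Hincr M HM _ l (admissible_young k Hk)). lra.
    - now apply (C_regular_transfer lam c Hge0 Hincr M HM _ l (admissible_young 1 (Rle_refl 1))). }
  assert (Hriesz : forall b, 0 < b -> (L_summable lam c l <-> Riesz_summable lam c b l)).
  { intros b Hb. rewrite HL, (Riesz_summable_iff lam c b l Hb). split.
    - apply (C_regular_transfer lam c Hge0 Hincr M HM _ l (admissible_riesz b Hb)). lra.
    - now apply (C_regular_transfer lam c Hge0 Hincr M HM _ l (admissible_young 1 (Rle_refl 1))). }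
  assert (Habel : L_summable lam c l <-> Abel_summable lam c l).
  { rewrite HL, (Abel_summable_iff lam c Hge0 Hincr M HM l). split.
    - apply (C_regular_transfer lam c Hge0 Hincr M HM _ l admissible_exp). lra.
    - apply (C_regular_transfer lam c Hge0 Hincr M HM _ l (admissible_young 1 (Rle_refl 1))). }
  split; [|split; [|split; [|split]]].
  - split.
    + intros H. exists 1. split; [lra|]. apply Hgamma; [lra|exact H].
    + intros (k & Hk & H). now apply (Hgamma k).
  - split.
    + intros H k Hk. now apply (Hgamma k).
    + intros H. apply (Hgamma 1); [lra|]. apply H. lra.
  - split.
    + intros H. exists 1. split; [lra|]. apply Hriesz; [lra|exact H].
    + intros (b & Hb & H). now apply (Hriesz b).
  - split.
    + intros H b Hb. now apply (Hriesz b).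
    + intros H. apply (Hriesz 1); [lra|]. apply H. lra.
  - exact Habel.
Qed.
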